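(* Let $P_0,P_1,P_2$ be three totally-real planes in $\mathbb{C}^2$ containing $0$, with $P_0\cap P_j=\{(0,0)\}$ for $j=1,2$. Let $g$ be a $\mathbb{C}$-linear isomorphism of $\mathbb{C}^2$ and $A_1,A_2\in\mathbb{R}^{2\times2}$ such that $g(P_0)=\mathbb{R}^2$ and $g(P_j)=(A_j+i\mathbb{I})\mathbb{R}^2$, $j=1,2$. Suppose that each of the pairwise unions $P_0\cup P_1$, $P_0\cup P_2$, $P_1\cup P_2$ is locally polynomially convex at $0\in\mathbb{C}^2$. Then $P_0\cup P_1\cup P_2$ is locally polynomially convex at $0$ if either (i) $\det[A_1,A_2]>0$ and $\det A_j>0$ for $j=1,2$; or (ii) $\det[A_1,A_2]<0$ and $\det A_j<0$ for $j=1,2$.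
   Context: A real 2-dimensional subspace $P\subset\mathbb{C}^2$ is totally real if $P\cap iP=\{0\}$. A closed set $E\subset\mathbb{C}^n$ is locally polynomially convex at $p\in E$ if $E\cap\overline{\mathbb{B}(p;r)}$ is polynomially convex (equal to its hull with respect to holomorphic polynomials) for some $r>0$. $[A,B]=AB-BA$. *)

(* Defs.v *)
From HB Require Import structures.
From mathcomp Require Import all_boot all_order all_algebra.
From mathcomp Require Import classical_sets reals.
From mathcomp.real_closed Require Import complex.
Set Implicit Arguments. Unset Strict Implicit. Unset Printing Implicit Defensive.
Import Order.TTheory GRing.Theory Num.Theory.
Local Open Scope ring_scope.
Local Open Scope complex_scope.
Local Open Scope classical_set_scope.

Section Defs.
Variable R : realType.

Definition C2 := 'cV[R[i]]_2.
Definition iC : R[i] := Complex 0 1.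
Definition coord1 (z : C2) : R[i] := z ord0 ord0.
Definition coord2 (z : C2) : R[i] := z ord_max ord0.

Definition hpoly_eval (n : nat) (c : 'I_n -> 'I_n -> R[i]) (z : C2) : R[i] :=
  \sum_(i < n) \sum_(j < n) c i j * coord1 z ^+ i * coord2 z ^+ j.

Definition cmod (x : R[i]) : R := ComplexField.Normc.normc x.
Definition cball2 (p : C2) (r : R) : set C2 :=
  [set z | cmod (coord1 z - coord1 p) ^+ 2 + cmod (coord2 z - coord2 p) ^+ 2 <= r ^+ 2].

Definition poly_hull (K : set C2) : set C2 :=
  [set z | forall (n : nat) (c : 'I_n -> 'I_n -> R[i]) (M : R),
      (forall w, K w -> cmod (hpoly_eval c w) <= M) -> cmod (hpoly_eval c z) <= M].

Definition poly_convex (K : set C2) : Prop := poly_hull K `<=` K.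

Definition loc_poly_convex (E : set C2) (p : C2) : Prop :=
  E p /\ exists r : R, 0 < r /\ poly_convex (E `&` cball2 p r).

Definition real_plane (P : set C2) : Prop :=
  exists u v : C2,
    (forall a b : R, a%:C *: u + b%:C *: v = 0 -> a = 0 /\ b = 0) /\
    P = [set z | exists a b : R, z = a%:C *: u + b%:C *: v].

Definition totally_real_plane (P : set C2) : Prop :=
  real_plane P /\ P `&` [set z | exists w, P w /\ z = iC *: w] = [set 0].

Definition mx_image (g : 'M[R[i]]_2) (P : set C2) : set C2 :=
  [set y | exists z, P z /\ y = g *m z].

Definition realC_mx m n (A : 'M[R]_(m, n)) : 'M[R[i]]_(m, n) :=
  map_mx (fun a => a%:C) A.

Definition R2 : set C2 := [set y | exists x : 'cV[R]_2, y = realC_mx x].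

Definition AiR2 (A : 'M[R]_2) : set C2 :=
  [set y | exists x : 'cV[R]_2, y = (realC_mx A + iC%:M) *m realC_mx x].

Definition comm_mx2 (A B : 'M[R]_2) : 'M[R]_2 := A *m B - B *m A.

End Defs.

(* Main.v *)
Require Import Defs.
From HB Require Import structures.
From mathcomp Require Import all_boot all_order all_algebra.
From mathcomp Require Import classical_sets reals boolp.
From mathcomp.real_closed Require Import complex.
From mathcomp Require Import ring lra.
Import Order.TTheory GRing.Theory Num.Theory.
Local Open Scope ring_scope.
Local Open Scope classical_set_scope.

(* With [J] the rotation by a right angle, the matrix [S = J [A1, A2]] is symmetric, and so are
   [S A1] and [S A2]; since [det (S Aj) = det [A1, A2] det Aj > 0], the latter are definite.  Hence
   the quadratic polynomial [Q z = (g z)^T S (g z)] is real on [P0], while on [Pj] its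
   imaginary part has a constant sign and dominates its real part.  If the signs on [P1]
   and [P2] agree, [Q] separates [P0] from the union of [P1] and [P2]; otherwise it separates
   the union of [P0] and [P1] from [P2]: one part goes to a closed half-plane, the other one to a
   sector in the opposite half-plane.  Kallin's argument then applies.  Adding a small
   multiple of [Q ^ 2] makes the separation strict off [0]; a point of the hull over a
   nonzero value lies in the hull of one of the two parts, because suitable rational
   functions with poles in the gaps between the half-plane and the sector are uniform limits of
   polynomials (push the poles to infinity).  Over the value [0] only [P0] matters, and there
   [D - (y1 - a1)^2 - (y2 - a2)^2], where [a] is the real part of the coordinates of the
   point, separates. *)

Local Notation Re := complex.Re.
Local Notation Im := complex.Im.

(** * Modulus, real part and imaginary part *)

Section Modulus.
Variable R : realType.
Implicit Types (x y z : R[i]) (a b : R).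

Lemma cmod_ge0 x : 0 <= cmod x.
Proof. by case: x => a b; apply: sqrtr_ge0. Qed.

Lemma cmodM x y : cmod (x * y) = cmod x * cmod y.
Proof. exact: ComplexField.Normc.normcM. Qed.

Lemma cmodV x : cmod x^-1 = (cmod x)^-1.
Proof. exact: ComplexField.Normc.normcV. Qed.

Lemma cmodN x : cmod (- x) = cmod x.
Proof. exact: normcN. Qed.

Lemma cmodD_le x y : cmod (x + y) <= cmod x + cmod y.
Proof. exact: le_normcD. Qed.

Lemma cmodB_le x y : cmod (x - y) <= cmod x + cmod y.
Proof. by rewrite -(cmodN y) cmodD_le. Qed.

Lemma cmodB_ge x y : cmod x - cmod y <= cmod (x - y).
Proof. by rewrite lerBlDr -{1}(subrK y x) cmodD_le. Qed.

Lemma cmodD_ge x y : cmod x - cmod y <= cmod (x + y).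
Proof. by rewrite -(cmodN y) -{2}(opprK y) cmodB_ge. Qed.

Lemma cmod0 : cmod (0 : R[i]) = 0.
Proof. exact: ComplexField.Normc.normc0. Qed.

Lemma cmod1 : cmod (1 : R[i]) = 1.
Proof. exact: ComplexField.Normc.normc1. Qed.

Lemma cmod_gt0 x : (0 < cmod x) = (x != 0).
Proof.
rewrite lt_neqAle cmod_ge0 andbT eq_sym; congr negb.
by apply/eqP/eqP => [/ComplexField.Normc.eq0_normc|->]; last exact: cmod0.
Qed.

Lemma cmodX x n : cmod (x ^+ n) = cmod x ^+ n.
Proof. by elim: n => [|n IH]; rewrite ?expr0 ?cmod1// !exprS cmodM IH. Qed.

Lemma sqr_cmod x : cmod x ^+ 2 = Re x ^+ 2 + Im x ^+ 2.
Proof. by case: x => a b; rewrite sqr_sqrtr// addr_ge0// sqr_ge0. Qed.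

Lemma normr_Re_le x : `|Re x| <= cmod x.
Proof.
by rewrite -ler_sqr ?nnegrE ?cmod_ge0// sqr_cmod -normrX ger0_norm ?sqr_ge0//
  lerDl sqr_ge0.
Qed.

Lemma normr_Im_le x : `|Im x| <= cmod x.
Proof.
by rewrite -ler_sqr ?nnegrE ?cmod_ge0// sqr_cmod -normrX ger0_norm ?sqr_ge0//
  lerDr sqr_ge0.
Qed.

Lemma cmod_le_ReIm x : cmod x <= `|Re x| + `|Im x|.
Proof.
rewrite -ler_sqr ?nnegrE ?cmod_ge0 ?addr_ge0// sqr_cmod sqrrD.
rewrite -2!normrX !(ger0_norm (sqr_ge0 _)).
by have := mulr_ge0 (normr_ge0 (Re x)) (normr_ge0 (Im x)); lra.
Qed.

Lemma cmod_real a : cmod (Complex a 0) = `|a|.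
Proof. by rewrite /cmod /= expr0n addr0 sqrtr_sqr. Qed.

Lemma cmod_sum_le (I : Type) (r : seq I) (F : I -> R[i]) :
  cmod (\sum_(i <- r) F i) <= \sum_(i <- r) cmod (F i).
Proof.
elim/big_rec2: _ => [|i a x _ le_ax]; first by rewrite cmod0.
by apply: le_trans (cmodD_le _ _) _; rewrite lerD2l.
Qed.

Lemma ReD x y : Re (x + y) = Re x + Re y. Proof. by case: x y => [? ?] []. Qed.
Lemma ImD x y : Im (x + y) = Im x + Im y. Proof. by case: x y => [? ?] []. Qed.
Lemma ReN x : Re (- x) = - Re x. Proof. by case: x. Qed.
Lemma ImN x : Im (- x) = - Im x. Proof. by case: x. Qed.
Lemma ReM x y : Re (x * y) = Re x * Re y - Im x * Im y.
Proof. by case: x y => [? ?] []. Qed.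
Lemma ImM x y : Im (x * y) = Re x * Im y + Im x * Re y.
Proof. by case: x y => [? ?] []. Qed.

End Modulus.

(** * Bernoulli-type inequalities for real powers *)

Section RealPowers.
Variable R : realType.
Implicit Types (x y e : R) (n : nat).

Lemma exists_natr_gt x : exists n, x < n.+1%:R.
Proof.
exists (Num.bound `|x|); apply: le_lt_trans (ler_norm x) _.
by apply: lt_trans (archi_boundP (normr_ge0 x)) _; rewrite ltr_nat.
Qed.

(** Bernoulli's inequality without division; the induction rests on [(1 - x) (1 + (n + 1) x) = 1 + n
    x - (n + 1) x^2]. It makes the decay of powers quantitative. *)
Lemma exprB1_natM_le1 x n : 0 <= x <= 1 -> (1 - x) ^+ n * (1 + n%:R * x) <= 1.
Proof.
case/andP=> x0 x1; elim: n => [|n IH]; first by rewrite expr0 mul0r addr0 mulr1.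
apply: le_trans IH; rewrite exprSr -mulrA ler_wpM2l ?exprn_ge0 ?subr_ge0//.
rewrite -natr1; have := mulr_ge0 (ler0n R n) (sqr_ge0 x); have := sqr_ge0 x.
by lra.
Qed.

(** The companion upper bound for growing powers, from [(1 + y) (1 - (n + 1) y) = 1 - n y - (n + 1)
    y^2]. *)
Lemma exprD1_natM_le1 y n : 0 <= y -> n%:R * y <= 1 ->
  (1 + y) ^+ n * (1 - n%:R * y) <= 1.
Proof.
move=> y0; elim: n => [|n IH]; first by rewrite expr0 mul0r subr0 mulr1.
rewrite -natr1 => ny; apply: le_trans (IH _); last by lra.
rewrite exprSr -mulrA ler_wpM2l ?exprn_ge0 ?addr_ge0//.
have := mulr_ge0 (ler0n R n) (sqr_ge0 y); have := sqr_ge0 y; lra.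
Qed.

Lemma exists_expr_le x e : 0 <= x < 1 -> 0 < e -> exists n, x ^+ n <= e.
Proof.
case/andP=> x0 x1 e0; have d0 : 0 < 1 - x by rewrite subr_gt0.
have [n ltn] := exists_natr_gt (e^-1 / (1 - x)); exists n.+1.
have /exprB1_natM_le1 : 0 <= 1 - x <= 1 by lra.
move=> /(_ n.+1); rewrite subKr; rewrite ltr_pdivrMr// in ltn.
have en : e^-1 <= 1 + n.+1%:R * (1 - x) by lra.
move=> /(le_trans (ler_wpM2l (exprn_ge0 _ x0) en)).
by rewrite ler_pdivrMr ?mul1r.
Qed.

End RealPowers.

(** * Polynomials in two variables and hulls *)

Section BivariatePolynomials.
Variable R : realType.
Implicit Types (P Q : {poly {poly R[i]}}) (z w : C2 R) (K : set (C2 R)).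

(** The outer indeterminate stands for the second coordinate, the inner one for the first. Unlike
    the coefficient tables of [hpoly_eval], these polynomials form a ring, so sums, products and
    powers come for free. *)
Definition bieval P z : R[i] := (P.[(coord2 z)%:P]).[coord1 z].

Lemma bievalD P Q z : bieval (P + Q) z = bieval P z + bieval Q z.
Proof. by rewrite /bieval !hornerD. Qed.

Lemma bievalN P z : bieval (- P) z = - bieval P z.
Proof. by rewrite /bieval !hornerN. Qed.

Lemma bievalB P Q z : bieval (P - Q) z = bieval P z - bieval Q z.
Proof. by rewrite bievalD bievalN. Qed.

Lemma bievalM P Q z : bieval (P * Q) z = bieval P z * bieval Q z.
Proof. by rewrite /bieval !hornerM. Qed.

Lemma bievalX P n z : bieval (P ^+ n) z = bieval P z ^+ n.
Proof. by rewrite /bieval !horner_exp. Qed.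

Lemma bievalC (x : R[i]) z : bieval x%:P%:P z = x.
Proof. by rewrite /bieval !hornerC. Qed.

Lemma bieval_sum (I : Type) (r : seq I) (F : I -> {poly {poly R[i]}}) z :
  bieval (\sum_(i <- r) F i) z = \sum_(i <- r) bieval (F i) z.
Proof. by rewrite /bieval !horner_sum. Qed.

Lemma bieval_coord1 z : bieval 'X%:P z = coord1 z.
Proof. by rewrite /bieval hornerC hornerX. Qed.

Lemma bieval_coord2 z : bieval 'X z = coord2 z.
Proof. by rewrite /bieval hornerX hornerC. Qed.

Lemma hpoly_evalP n (c : 'I_n -> 'I_n -> R[i]) :
  exists P, forall z, hpoly_eval c z = bieval P z.
Proof.
exists (\sum_(i < n) \sum_(j < n) (c i j)%:P%:P * 'X%:P ^+ i * 'X ^+ j) => z.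
rewrite bieval_sum; apply: eq_bigr => i _.
rewrite bieval_sum; apply: eq_bigr => j _.
by rewrite !bievalM !bievalX bievalC bieval_coord1 bieval_coord2.
Qed.

Lemma bievalP P :
  exists (n : nat) (c : 'I_n -> 'I_n -> R[i]), forall z, bieval P z = hpoly_eval c z.
Proof.
(* The tables of [hpoly_eval] are square, so one [n] has to bound the degrees in both variables. *)
pose n := maxn (size P) (\max_(j < size P) size (P`_j)%R).
have szc (j : nat) : (size (P`_j)%R <= n)%N.
  have [ltj|lej] := ltnP j (size P); last by rewrite nth_default// size_poly0.
  by rewrite leq_max (leq_bigmax (Ordinal ltj)) orbT.
exists n, (fun i j => P`_j`_i) => z.
rewrite /bieval (horner_coef_wide _ (leq_maxl _ _ : size P <= n)%N).
rewrite horner_sum /hpoly_eval exchange_big; apply: eq_bigr => j _.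
rewrite hornerM -polyC_exp hornerC (horner_coef_wide _ (szc j)) mulr_suml.
by apply: eq_bigr.
Qed.

Lemma poly_hullP K z :
  poly_hull K z <->
  forall P (M : R), (forall w, K w -> cmod (bieval P w) <= M) -> cmod (bieval P z) <= M.
Proof.
split=> [Kz P M bndP|Kz n c M bndc].
  have [n [c Pc]] := bievalP P.
  by rewrite Pc; apply: Kz => w /bndP; rewrite Pc.
by have [P cP] := hpoly_evalP _ c; rewrite cP; apply: Kz => w /bndc; rewrite cP.
Qed.

Lemma poly_hullS K K' : K `<=` K' -> poly_hull K `<=` poly_hull K'.
Proof. by move=> sKK z Kz n c M bnd; apply: Kz => w /sKK; exact: bnd. Qed.

(** A separating polynomial is normalised at [z] and raised to a high power. *)
Lemma not_poly_hullP K z (e : R) : 0 < e -> ~ poly_hull K z ->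
  exists P, bieval P z = 1 /\ forall w, K w -> cmod (bieval P w) <= e.
Proof.
move=> e0 /poly_hullP/existsNP[P] /existsNP[M] /not_implyP[bndP /negP].
rewrite -ltNge => MPz; have [Pz0|Pz0] := eqVneq (bieval P z) 0.
  (* Here [M < 0], so [K] has no point and the constant [1] serves. *)
  exists 1%:P%:P; split=> [|w /bndP]; first exact: bievalC.
  by rewrite Pz0 cmod0 in MPz; have := cmod_ge0 _ (bieval P w); lra.
rewrite -cmod_gt0 in Pz0; pose N := Num.max M 0.
have N0 : 0 <= N by rewrite le_max lexx orbT.
have ltNP : N < cmod (bieval P z) by rewrite gt_max MPz Pz0.
have [|n len] := @exists_expr_le R (N / cmod (bieval P z)) e _ e0.
  by rewrite divr_ge0 ?cmod_ge0//= ltr_pdivrMr// mul1r.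
exists (((bieval P z)^-1%:P%:P * P) ^+ n); split=> [|w Kw].
  by rewrite bievalX bievalM bievalC mulVf ?expr1n// -cmod_gt0.
rewrite bievalX bievalM bievalC cmodX cmodM cmodV mulrC; apply: le_trans len.
rewrite lerXn2r ?nnegrE ?divr_ge0 ?cmod_ge0// ler_pM2r ?invr_gt0//.
by rewrite le_max bndP.
Qed.

End BivariatePolynomials.

(** * Uniform limits of polynomials on a set *)

Section UniformApproximation.
Variables (R : realType) (T : set (C2 R)).
Implicit Types (F G : C2 R -> R[i]) (P : {poly {poly R[i]}}).

Definition bounded_on F := exists M : R, forall w, T w -> cmod (F w) <= M.

(** Boundedness is part of the notion because it makes the class stable under products. *)
Definition approximable F :=
  bounded_on F /\
  forall e : R, 0 < e -> exists P, forall w, T w -> cmod (bieval R P w - F w) <= e.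

Lemma eq_approximable F G :
  (forall w, T w -> F w = G w) -> approximable F -> approximable G.
Proof.
move=> FG [[M bM] aF]; split; first by exists M => w Tw; rewrite -FG// bM.
by move=> e /aF[P aP]; exists P => w Tw; rewrite -FG// aP.
Qed.

Lemma approximable_bieval P : bounded_on (bieval R P) -> approximable (bieval R P).
Proof. by move=> bP; split=> // e e0; exists P => w _; rewrite subrr cmod0 ltW. Qed.

Lemma approximable_cst (c : R[i]) : approximable (fun=> c).
Proof.
split; first by exists (cmod c).
by move=> e e0; exists c%:P%:P => w _; rewrite bievalC subrr cmod0 ltW.
Qed.

Lemma approximableD F G :
  approximable F -> approximable G -> approximable (fun w => F w + G w).
Proof.
move=> [[M bF] aF] [[N bG] aG]; split.
  exists (M + N) => w Tw; apply: le_trans (cmodD_le _ _ _) _.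
  by rewrite lerD ?bF ?bG.
move=> e e0; have e20 : 0 < e / 2 by lra.
have [P aP] := aF _ e20; have [Q aQ] := aG _ e20; exists (P + Q) => w Tw.
rewrite bievalD opprD addrACA; apply: le_trans (cmodD_le _ _ _) _.
by have := aP _ Tw; have := aQ _ Tw; lra.
Qed.

Lemma approximableM F G :
  approximable F -> approximable G -> approximable (fun w => F w * G w).
Proof.
move=> [[M bF] aF] [[N bG] aG]; split.
  exists (M * N) => w Tw; rewrite cmodM.
  by rewrite ler_pM ?cmod_ge0 ?bF ?bG.
move=> e e0; pose K := `|M| + `|N| + 1.
have K0 : 0 < K by rewrite /K; have := normr_ge0 M; have := normr_ge0 N; lra.
(* With [d <= 1] the quadratic error is at most [d], so the total error is at most
   [d K <= e / 2]. *)
pose d := Num.min 1 (e / (2 * K)).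
have d1 : d <= 1 by rewrite ge_min lexx.
have dK : 2 * K * d <= e.
  by rewrite mulrC -ler_pdivlMr ?ge_min ?lexx ?orbT//; lra.
have d0 : 0 < d by rewrite lt_min ltr01 divr_gt0//; lra.
have [P aP] := aF _ d0; have [Q aQ] := aG _ d0; exists (P * Q) => w Tw.
rewrite bievalM; set p := bieval R P w; set q := bieval R Q w.
have -> : p * q - F w * G w = (p - F w) * (q - G w) + (p - F w) * G w + F w * (q - G w).
  by ring.
apply: le_trans (cmodD_le _ _ _) _; rewrite cmodM.
apply: le_trans (lerD (cmodD_le _ _ _) (lexx _)) _; rewrite !cmodM.
have Pw := aP _ Tw; have Qw := aQ _ Tw; have := bF _ Tw; have := bG _ Tw.
have := cmod_ge0 _ (p - F w); have := cmod_ge0 _ (q - G w).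
have := cmod_ge0 _ (F w); have := cmod_ge0 _ (G w).
have := ler_norm M; have := ler_norm N.
rewrite -/p -/q in Pw Qw *; rewrite /K in dK K0 *.
set a := cmod (p - _) in Pw *; set b := cmod (q - _) in Qw *.
set f := cmod (F _); set g := cmod (G _) => lN lM g0 f0 b0 a0 gN fM.
have : a * b <= d * 1 by rewrite ler_pM//; lra.
have : a * g <= d * `|N| by rewrite ler_pM//; lra.
have : f * b <= `|M| * d by rewrite ler_pM//; lra.
by have := normr_ge0 M; have := normr_ge0 N; nra.
Qed.

Lemma approximableX F n : approximable F -> approximable (fun w => F w ^+ n).
Proof.
move=> aF; elim: n => [|n IH].
  exact: eq_approximable (approximable_cst 1).
by apply: eq_approximable (approximableM _ _ aF IH) => w _; rewrite exprS.
Qed.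

Lemma approximable_uniform_limit F :
  (forall e : R, 0 < e -> exists2 G, approximable G &
     forall w, T w -> cmod (G w - F w) <= e) -> approximable F.
Proof.
move=> limF; split.
  have [G [[M bG] _] GF] := limF 1 ltr01; exists (M + 1) => w Tw.
  have -> : F w = G w - (G w - F w) by rewrite subKr.
  by apply: le_trans (cmodB_le _ _ _) _; rewrite lerD ?bG ?GF.
move=> e e0; have e20 : 0 < e / 2 by lra.
have [G [_ aG] GF] := limF _ e20; have [P PG] := aG _ e20; exists P => w Tw.
have -> : bieval R P w - F w = (bieval R P w - G w) + (G w - F w) by ring.
apply: le_trans (cmodD_le _ _ _) _.
by have := PG _ Tw; have := GF _ Tw; lra.
Qed.

Lemma approximable_sumX F n :
  approximable F -> approximable (fun w => \sum_(k < n) F w ^+ k).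
Proof.
move=> aF; elim: n => [|n IH].
  by apply: eq_approximable (approximable_cst 0) => w _; rewrite big_ord0.
apply: eq_approximable (approximableD _ _ IH (approximableX F n aF)) => w _.
by rewrite big_ord_recr.
Qed.

(** Geometric series: the remainder [F^n / (1 - F)] has modulus at most [2 / 2^n]. *)
Lemma approximable_geometric F : approximable F ->
  (forall w, T w -> cmod (F w) <= 2^-1) -> approximable (fun w => (1 - F w)^-1).
Proof.
move=> aF leF; apply: approximable_uniform_limit => e e0.
have [||n len] := @exists_expr_le R 2^-1 (e / 2); [lra|lra|].
exists (fun w => \sum_(k < n) F w ^+ k); first exact: approximable_sumX.
move=> w Tw; have Fw := leF w Tw.
have F1 : 2^-1 <= cmod (1 - F w).
  by apply: le_trans (cmodB_ge _ _ _); rewrite cmod1; lra.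
have nz : 1 - F w != 0 by rewrite -cmod_gt0; lra.
have -> : \sum_(k < n) F w ^+ k - (1 - F w)^-1 = - (F w ^+ n / (1 - F w)).
  apply: (mulfI nz); rewrite mulrBr mulfV// mulrN mulrCA mulfV// mulr1.
  by have := subrX1 (F w) n; rewrite -(opprB 1 (F w)) mulNr => /eqP;
     rewrite -eqr_oppLR => /eqP <-; ring.
rewrite cmodN cmodM cmodX cmodV.
have -> : e = e / 2 * 2 by field.
apply: ler_pM; rewrite ?exprn_ge0 ?invr_ge0 ?cmod_ge0//.
  by apply: le_trans len; rewrite lerXn2r ?nnegrE ?cmod_ge0//; lra.
by rewrite -[2]invrK lef_pV2 ?posrE//; lra.
Qed.

(** Expansion at infinity: [1 / (F - a) = - a^-1 / (1 - F / a)] with [|F / a| <= 1 / 2]. *)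
Lemma approximable_pole_far F (a : R[i]) (M : R) : approximable F ->
  (forall w, T w -> cmod (F w) <= M) -> 0 < cmod a -> 2 * M <= cmod a ->
  approximable (fun w => (F w - a)^-1).
Proof.
move=> aF bF a0 Ma; have nza : a != 0 by rewrite -cmod_gt0.
have aFa := approximableM _ _ (approximable_cst a^-1) aF.
have bFa w : T w -> cmod (a^-1 * F w) <= 2^-1.
  move=> Tw; rewrite cmodM cmodV mulrC ler_pdivrMr//.
  by have := bF w Tw; lra.
have := approximableM _ _ (approximable_cst (- a^-1)) (approximable_geometric _ aFa bFa).
apply: eq_approximable => w Tw.
by rewrite -invrN -invfM mulNr mulrBr mulr1 mulrA mulfV// mul1r opprB.
Qed.

(** Re-expansion about the old pole: [1 / (F - b)] is the product of [1 / (F - a)] and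
    [1 / (1 - (b - a) / (F - a))], where the quotient has modulus at most [1 / 2]. *)
Lemma approximable_pole_step F (a b : R[i]) (d : R) : 0 < d ->
  (forall w, T w -> d <= cmod (F w - a)) -> cmod (b - a) <= d / 2 ->
  approximable (fun w => (F w - a)^-1) -> approximable (fun w => (F w - b)^-1).
Proof.
move=> d0 dF ba aF; have nz w : T w -> F w - a != 0.
  by move=> /dF dw; rewrite -cmod_gt0; lra.
have aFb := approximableM _ _ (approximable_cst (b - a)) aF.
have bFb w : T w -> cmod ((b - a) * (F w - a)^-1) <= 2^-1.
  move=> Tw; rewrite cmodM cmodV ler_pdivrMr ?cmod_gt0 ?nz//.
  by have := dF w Tw; lra.
apply: eq_approximable (approximableM _ _ aF (approximable_geometric _ aFb bFb)) => w Tw.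
rewrite -invfM mulrBr mulr1 mulrCA mulfV ?nz// mulr1; congr (_^-1); ring.
Qed.

(* The pole is pushed to infinity along the ray [a + t u] in steps of length [d / 2]. *)
Lemma approximable_pole F (a u : R[i]) (d : R) : approximable F -> 0 < d ->
  cmod u = 1 ->
  (forall w (t : R), T w -> 0 <= t -> d <= cmod (F w - (a + Complex t 0 * u))) ->
  approximable (fun w => (F w - a)^-1).
Proof.
move=> aF d0 u1 dF; have [[M bF] _] := aF.
pose c k := a + Complex (k%:R * (d / 2)) 0 * u.
have kd0 k : 0 <= k%:R * (d / 2) by rewrite mulr_ge0 ?ler0n//; lra.
(* Taking [M' >= 1] keeps the last pole away from [0], as the expansion at infinity requires. *)
pose M' := Num.max M 1; have [k ltk] := exists_natr_gt R ((2 * M' + cmod a) / (d / 2)).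
rewrite ltr_pdivrMr in ltk; last by lra.
have far : approximable (fun w => (F w - c k.+1)^-1).
  have lec : 2 * M' <= cmod (c k.+1).
    rewrite /c addrC; apply: le_trans (cmodD_ge _ _ _).
    by rewrite cmodM u1 mulr1 cmod_real ger0_norm ?kd0//; lra.
  have M1 : 1 <= M' by rewrite le_max lexx orbT.
  have MM : M <= M' by rewrite le_max lexx.
  by apply: (approximable_pole_far F _ M' aF) => [w /bF||//]; lra.
have: approximable (fun w => (F w - c 0%N)^-1).
  (* Downward induction, from the far pole [c k.+1] back to [c 0 = a]. *)
  elim: k.+1 far => // j IH far; apply: IH.
  apply: (approximable_pole_step F (c j.+1) (c j) d) far => // [w Tw|]; first exact: dF.
  have -> : c j - c j.+1 = - (Complex (d / 2) 0 * u).
    rewrite /c; have -> : Complex (j.+1%:R * (d / 2)) 0 =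
        Complex (j%:R * (d / 2)) 0 + Complex (d / 2) 0 :> R[i].
      by apply/eqP; rewrite eq_complex /= -natr1 mulrDl mul1r !addr0 !eqxx.
    by ring.
  by rewrite cmodN cmodM u1 mulr1 cmod_real ger0_norm//; lra.
apply: eq_approximable => w _; rewrite /c mul0r; congr (_ ^-1).
by rewrite (_ : Complex 0 0 = 0) ?mul0r ?addr0.
Qed.

End UniformApproximation.

(** The inequality defining the hull passes to uniform limits, provided that the approximation holds
    at [z] too. Every contradiction with hull membership below comes from here. *)
Lemma poly_hull_approximable (R : realType) (X : set (C2 R)) z (F : C2 R -> R[i]) (M : R) :
  poly_hull X z -> approximable R (X `|` [set z]) F ->
  (forall w, X w -> cmod (F w) <= M) -> cmod (F z) <= M.
Proof.
move=> /poly_hullP Xz [_ aF] bF; apply/ler_addgt0Pr => e e0.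
have e20 : 0 < e / 2 by lra.
have [P aP] := aF _ e20; have : cmod (bieval R P z) <= M + e / 2.
  apply: Xz => w Xw; have -> : bieval R P w = F w + (bieval R P w - F w) by ring.
  apply: le_trans (cmodD_le _ _ _) _.
  by have := bF _ Xw; have := aP w (or_introl Xw); lra.
have -> : F z = bieval R P z - (bieval R P z - F z) by rewrite subKr.
move=> Pz; apply: le_trans (cmodB_le _ _ _) _.
by have := aP z (or_intror erefl); lra.
Qed.

(** * Inverses of polynomial expressions *)

Section InversePolynomial.
Variables (R : realType) (T : set (C2 R)).

(** Over an algebraically closed field the inverse is a product of simple poles, one for each root
    with multiplicity. *)
Lemma approximable_inv_horner (F : C2 R -> R[i]) (p : {poly R[i]}) :
  (forall z, root p z -> approximable R T (fun w => (F w - z)^-1)) ->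
  approximable R T (fun w => p.[F w]^-1).
Proof.
have [->|nzp] := eqVneq p 0.
  (* The inverse of [0] is [0], so the zero polynomial gives a constant function. *)
  move=> _; apply: eq_approximable (approximable_cst R T 0) => w _.
  by rewrite horner0 invr0.
have [r pE] := closed_field_poly_normal p => aF.
have ar : approximable R T (fun w => \prod_(z <- r) (F w - z)^-1).
  have: forall z, z \in r -> root p z.
    by move=> z rz; rewrite pE rootZ ?lead_coef_eq0// root_prod_XsubC.
  elim: (r) => [|z r' IH] sr.
    by apply: eq_approximable (approximable_cst R T 1) => w _; rewrite big_nil.
  have az := aF z (sr z (mem_head _ _)).
  have ar' := IH (fun y r'y => sr y (mem_behead (s := z :: r') r'y)).
  apply: eq_approximable (approximableM R T _ _ az ar') => w _.
  by rewrite big_cons.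
have al := approximable_cst R T (lead_coef p)^-1.
apply: eq_approximable (approximableM R T _ _ al ar) => w _.
rewrite {2}pE hornerZ horner_prod invfM; congr (_ * _).
by rewrite -prodfV; apply: eq_bigr => z _; rewrite hornerXsubC.
Qed.

End InversePolynomial.

(** * Rational functions separating the two half-planes *)

Section SeparatingFunctions.
Variable R : realType.
Implicit Types (v : R[i]) (n : nat).

(** The common denominator of [(1 - v)^n / sepden n v] and [(1 + v)^n / sepden n v]. These add up to
    [1] off its zeros and approximate, for large [n], the indicators of the left and the right
    half-plane. *)
Definition sepden n v := (1 + v) ^+ n + (1 - v) ^+ n.

Lemma sepdenN n v : sepden n (- v) = sepden n v.
Proof. by rewrite /sepden opprK addrC. Qed.

(** Let [x] be the fraction in the statement. Since [|1 + v|^2 = |1 - v|^2 + 4 Re v] and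
    [|1 - v| <= 1 + B], one gets [|1 + v|^2 <= (1 - 2 x) |1 - v|^2 <= (1 - x)^2 |1 - v|^2];
    Bernoulli's inequality concludes. *)
Lemma cmod_expr_half_plane v (B : R) n : cmod v <= B -> Re v <= 0 ->
  cmod (1 + v) ^+ n * (1 + n%:R * (2 * - Re v / (1 + B) ^+ 2)) <= cmod (1 - v) ^+ n.
Proof.
move=> vB v0; set x := 2 * - Re v / _.
have B0 : 0 <= B := le_trans (cmod_ge0 _ _) vB.
have B2 : 0 < (1 + B) ^+ 2 by rewrite exprn_gt0//; lra.
have xE : x * (1 + B) ^+ 2 = 2 * - Re v by rewrite /x divfK// gt_eqF.
have x0 : 0 <= x by rewrite /x divr_ge0 ?(ltW B2)//; lra.
have x1 : x <= 1.
  rewrite /x ler_pdivrMr//; have := normr_Re_le _ v; have := ler_norm (- Re v).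
  by rewrite normrN; nra.
have le1 : cmod (1 + v) <= cmod (1 - v) * (1 - x).
  rewrite -ler_sqr ?nnegrE ?mulr_ge0 ?cmod_ge0 ?subr_ge0//.
  rewrite exprMn !sqr_cmod !ReD !ImD ReN ImN /=.
  have := sqr_cmod _ (1 - v); rewrite !ReD !ImD ReN ImN /= !add0r.
  have le2 : cmod (1 - v) ^+ 2 <= (1 + B) ^+ 2.
    rewrite lerXn2r ?nnegrE ?cmod_ge0//; first by lra.
    by apply: le_trans (cmodB_le _ _ _) _; rewrite cmod1 lerD2l.
  move: le2; set q := cmod _ ^+ 2 => le2 qE; rewrite -qE.
  have qq : (1 + Re v) ^+ 2 + Im v ^+ 2 = q - 4 * - Re v by rewrite qE; ring.
  have q0 : 0 <= q by rewrite /q exprn_ge0 ?cmod_ge0.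
  have := ler_wpM2l x0 le2; rewrite qq xE; have := mulr_ge0 q0 (sqr_ge0 x); nra.
have xn : 0 <= 1 + n%:R * x by have := mulr_ge0 (ler0n R n) x0; lra.
apply: le_trans (_ : (cmod (1 - v) * (1 - x)) ^+ n * (1 + n%:R * x) <= _).
  rewrite ler_wpM2r// lerXn2r ?nnegrE ?mulr_ge0 ?cmod_ge0 ?subr_ge0//.
rewrite exprMn -mulrA ler_piMr ?exprn_ge0 ?cmod_ge0//.
by rewrite exprB1_natM_le1 ?x0.
Qed.

Lemma cmod_1B_gt0 v : Re v <= 0 -> 0 < cmod (1 - v).
Proof.
move=> v0; apply: lt_le_trans (normr_Re_le _ _); rewrite ReD ReN /=.
by apply: lt_le_trans (ler_norm _); lra.
Qed.

Lemma sepden_far v (B y : R) n : cmod v <= B -> Re v <= 0 -> 0 < y ->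
  y <= n%:R * (2 * - Re v / (1 + B) ^+ 2) ->
  [/\ sepden n v != 0, cmod ((1 - v) ^+ n / sepden n v) <= 1 + y^-1
    & cmod ((1 + v) ^+ n / sepden n v) <= y^-1].
Proof.
move=> vB v0 y0 yn; have := cmod_expr_half_plane v B n vB v0.
have := cmodD_ge _ ((1 - v) ^+ n) ((1 + v) ^+ n).
rewrite [(1 - v) ^+ n + _]addrC -/(sepden n v) !cmodX; have : 0 < cmod (1 - v) ^+ n by rewrite exprn_gt0// cmod_1B_gt0.
have : 0 <= cmod (1 + v) ^+ n by rewrite exprn_ge0// cmod_ge0.
rewrite 2!cmodM cmodV 2!cmodX.
set b := cmod (1 + v) ^+ n; set a := cmod (1 - v) ^+ n; set D := cmod _.
move=> b0 a0 abD; set Y := n%:R * _ in yn * => ba.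
have by1 : b * (1 + y) <= a by apply: le_trans ba; rewrite ler_wpM2l// lerD2l.
have D0 : 0 < D by nra.
split; first by rewrite -cmod_gt0.
  rewrite ler_pdivrMr// -(ler_pM2l y0) mulrA mulrDr mulfV ?gt_eqF//; nra.
by rewrite ler_pdivrMr// -(ler_pM2l y0) mulrA mulfV ?gt_eqF// mul1r; nra.
Qed.

(** On the closed left half-plane [|1 + v| <= |1 - v|], so the denominator is at most twice the
    numerator. *)
Lemma sepden_half v n : Re v <= 0 -> sepden n v != 0 ->
  2^-1 <= cmod ((1 - v) ^+ n / sepden n v).
Proof.
move=> v0; rewrite -cmod_gt0 => D0; rewrite cmodM cmodV ler_pdivlMr// cmodX.
have := cmod_expr_half_plane v (cmod v) n (lexx _) v0.
have Y0 : 0 <= n%:R * (2 * - Re v / (1 + cmod v) ^+ 2).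
  by rewrite mulr_ge0 ?ler0n// divr_ge0 ?exprn_ge0 ?addr_ge0 ?cmod_ge0//; lra.
have := cmodD_le _ ((1 + v) ^+ n) ((1 - v) ^+ n); rewrite -/(sepden n v) !cmodX.
have : 0 <= cmod (1 + v) ^+ n by rewrite exprn_ge0// cmod_ge0.
set b := cmod (1 + v) ^+ n; set a := cmod (1 - v) ^+ n.
by move: Y0; set Y := n%:R * _ => Y0 b0 Dab ba; nra.
Qed.

Lemma cmod_exprD1_sub1 v n : cmod ((1 + v) ^+ n - 1) <= (1 + cmod v) ^+ n - 1.
Proof.
elim: n => [|n IH]; first by rewrite !expr0 !subrr cmod0.
have -> : (1 + v) ^+ n.+1 - 1 = ((1 + v) ^+ n - 1) * (1 + v) + v.
  by rewrite exprSr; ring.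
apply: le_trans (cmodD_le _ _ _) _; rewrite cmodM.
have le1 : cmod (1 + v) <= 1 + cmod v by rewrite -(cmod1 R) cmodD_le.
have := ler_pM (cmod_ge0 _ _) (cmod_ge0 _ _) IH le1.
by rewrite exprSr; lra.
Qed.

Lemma cmod_exprD1_near v n : 3 * (n%:R * cmod v) <= 1 ->
  cmod ((1 + v) ^+ n - 1) <= 2^-1.
Proof.
move=> nv; apply: le_trans (cmod_exprD1_sub1 v n) _.
have := exprD1_natM_le1 R (cmod v) n (cmod_ge0 _ v).
have : 0 <= (1 + cmod v) ^+ n by rewrite exprn_ge0// addr_ge0// cmod_ge0.
set A := _ ^+ n => A0 le1; have {}le1 := le1 _; nra.
Qed.

(** Both powers are within [1 / 2] of [1], so the denominator is within [1] of [2]. *)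
Lemma sepden_near v n : 3 * (n%:R * cmod v) <= 1 ->
  [/\ sepden n v != 0, cmod ((1 - v) ^+ n / sepden n v) <= 3 / 2
    & cmod ((1 + v) ^+ n / sepden n v) <= 3 / 2].
Proof.
move=> nv; have nv' : 3 * (n%:R * cmod (- v)) <= 1 by rewrite cmodN.
have := cmod_exprD1_near v n nv; have := cmod_exprD1_near (- v) n nv'.
set a := (1 - v) ^+ n; set b := (1 + v) ^+ n => a1 b1.
have D1 : 1 <= cmod (sepden n v).
  have -> : sepden n v = 1 + 1 + ((a - 1) + (b - 1)) by rewrite /sepden -/a -/b; ring.
  apply: le_trans (cmodD_ge _ _ _); have := cmodD_le _ (a - 1) (b - 1).
  have -> : 1 + 1 = Complex (1 + 1) 0 :> R[i] by apply/eqP; rewrite eq_complex /= addr0 !eqxx.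
  by rewrite cmod_real ger0_norm; lra.
have le32 (x : R[i]) : cmod (x - 1) <= 2^-1 -> cmod x <= 3 / 2.
  by move=> x1; have := cmodB_ge _ x 1; rewrite cmod1; lra.
split; first by rewrite -cmod_gt0; lra.
  rewrite cmodM cmodV ler_pdivrMr; last by lra.
  by have := le32 _ a1; have := cmod_ge0 _ a; nra.
rewrite cmodM cmodV ler_pdivrMr; last by lra.
by have := le32 _ b1; have := cmod_ge0 _ b; nra.
Qed.

(** At a root [|1 + v| = |1 - v|], which puts [v] on the imaginary axis; the previous lemma excludes
    a neighbourhood of [0]. *)
Lemma sepden_root v n : (0 < n)%N -> sepden n v = 0 ->
  Re v = 0 /\ 1 < 3 * (n%:R * `|Im v|).
Proof.
move=> n0 D0; have Re0 : Re v = 0.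
  have : (1 + v) ^+ n = - (1 - v) ^+ n by apply/eqP; rewrite -addr_eq0; apply/eqP.
  move=> /(congr1 (@cmod R)); rewrite cmodN !cmodX => /eqP.
  rewrite eqrXn2 ?cmod_ge0// => /eqP /(congr1 (fun x : R => x ^+ 2)).
  by rewrite !sqr_cmod !ReD !ImD ReN ImN /=; lra.
split=> //; rewrite ltNge; apply/negP => le1.
have cv : cmod v = `|Im v|.
  apply/eqP; rewrite eq_le normr_Im_le andbT.
  by apply: le_trans (cmod_le_ReIm _ v) _; rewrite Re0 normr0 add0r.
by have [] := sepden_near v n; rewrite ?cv// D0 eqxx.
Qed.

End SeparatingFunctions.

(** * Kallin's argument *)

Section Kallin.
Variable R : realType.

(** The ray leaves [a] vertically, away from the real axis. Its real part is constant and the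
    modulus of its imaginary part grows, so it stays in the gap between half-plane and sector; poles
    can escape to infinity along it. *)
Lemma gap_ray_dist (c d t : R) (a x : R[i]) : 0 < c <= 1 -> 0 <= t ->
  d <= Re a -> d * 2 <= c * `|Im a| - Re a ->
  Re x <= 0 \/ c * `|Im x| <= Re x ->
  d <= cmod (x - (a + Complex t 0 * Complex 0 (if 0 <= Im a then 1 else -1))).
Proof.
case/andP=> c0 c1 t0 da dh xL; set e : R := if _ then _ else _; set y := x - _.
have Ry : Re y = Re x - Re a by rewrite /y ReD ReN ReD ReM /=; ring.
have Iy : Im y = Im x - (Im a + t * e) by rewrite /y ImD ImN ImD ImM /=; ring.
have aE : `|Im a + t * e| = `|Im a| + t.
  rewrite /e; have [Ia0|/ltW Ia0] := leP 0 (Im a).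
    by rewrite mulr1 !ger0_norm// addr_ge0.
  by rewrite mulrN1 !ler0_norm ?opprB ?opprK 1?addrC//; lra.
have := normr_Re_le _ y; have := normr_Im_le _ y; rewrite Ry Iy.
case: xL => [x0|xL].
  by have := ler_norm (- (Re x - Re a)); rewrite normrN; lra.
have := lerB_dist (Im a + t * e) (Im x); rewrite distrC aE.
have := ler_norm (Re x - Re a) => leR le1 le2 le3.
have := ler_wpM2l (ltW c0) le1; have := ler_wpM2l (ltW c0) le2.
have : c * cmod y <= cmod y by rewrite ler_piMl ?cmod_ge0.
by have := mulr_ge0 (ltW c0) t0; lra.
Qed.

(** The functions are the two quotients over [sepden n] at [F - s], for a small shift [s] and a
    large [n]. The bound [C] comes before [sg] and [tau], so both may be chosen in terms of it. *)
Lemma half_plane_sector_separation (T : set (C2 R)) (F : C2 R -> R[i]) (c : R) :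
  approximable R T F -> 0 < c <= 1 ->
  (forall w, T w -> Re (F w) <= 0 \/ c * `|Im (F w)| <= Re (F w)) ->
  exists C : R, forall sg tau : R, 0 < sg -> 0 < tau ->
  exists f1 f2 : C2 R -> R[i],
    [/\ approximable R T f1, approximable R T f2,
      (forall w, T w -> cmod (f1 w) <= C /\ cmod (f2 w) <= C),
      (forall w, T w -> Re (F w) <= 0 -> 2^-1 <= cmod (f1 w)) /\
      (forall w, T w -> Re (F w) <= - sg -> cmod (f2 w) <= tau) &
      (forall w, T w -> sg <= Re (F w) -> cmod (f1 w) <= tau /\ 2^-1 <= cmod (f2 w))].
Proof.
move=> aF /andP[c0 c1] FT; have [[M' bF'] _] := aF.
pose M := Num.max M' 0; have M0 : 0 <= M by rewrite le_max lexx orbT.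
have bF w : T w -> cmod (F w) <= M by move=> /bF' ?; rewrite le_max; apply/orP; left.
pose B := M + 1; pose K := (1 + B) ^+ 2.
have K0 : 0 < K by rewrite exprn_gt0 ?/B//; lra.
(* This is [n (2 s / K)] for the shift [s] below, whatever [n] is, since [n s = c / 9]; hence the
   uniform bound. *)
pose y0 := 2 * (c / 9) / K.
have y00 : 0 < y0 by rewrite divr_gt0//; lra.
exists (2 + y0^-1) => sg tau sg0 tau0.
(* The first bound gives [s <= sg / 2], the second one makes the decay beyond [sg / 2] smaller than
   [tau]. *)
have [m ltm] := exists_natr_gt R (Num.max (2 / sg) (K / sg / tau)); pose n := m.+1.
have n0 : 0 < n%:R :> R by rewrite ltr0n.
have n1 : 1 <= n%:R :> R by rewrite ler1n.
move: ltm; rewrite -/n gt_max => /andP[]; rewrite !ltr_pdivrMr// => nsg nK.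
(* A root [z] of the denominator has [c |Im z| > c / (3 n) = 3 s], so the pole [z + s] lies in the
   gap, at the distance [s] required by [gap_ray_dist]. The same [9] gives [3 n |v| <= 1] in the
   strip [|Re v| <= s]. *)
pose s := c / 9 / n%:R; have s0 : 0 < s by rewrite divr_gt0//; lra.
have ns : n%:R * s = c / 9 by rewrite mulrC divfK// gt_eqF.
have s1 : s <= 1 by rewrite ler_pdivrMr//; lra.
have ssg : s <= sg / 2 by rewrite ler_pdivrMr//; lra.
pose v w := F w - Complex s 0.
have Rev w : Re (v w) = Re (F w) - s by rewrite /v ReD ReN.
have Imv w : Im (v w) = Im (F w) by rewrite /v ImD ImN /= oppr0 addr0.
have av : approximable R T v.
  exact: (approximableD R T _ _ aF (approximable_cst R T (- Complex s 0))).
have vB w : T w -> cmod (v w) <= B.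
  move=> Tw; apply: le_trans (cmodB_le _ _ _) _.
  by rewrite cmod_real (ger0_norm (ltW s0)) lerD ?bF.
have vE w : v w = F w - Complex s 0 by [].
clearbody v; pose p : {poly R[i]} := (1 + 'X) ^+ n + (1 - 'X) ^+ n.
have pE x : p.[x] = sepden R n x.
  by rewrite hornerD !horner_exp !hornerD hornerN hornerX hornerC.
have aD : approximable R T (fun w => (sepden R n (v w))^-1).
  have: approximable R T (fun w => p.[v w]^-1).
    apply: approximable_inv_horner => z /rootP; rewrite pE.
    move=> /(sepden_root R z n (ltn0Sn _))[Rz Iz].
    have Iz3 : s * 3 <= c * `|Im z|.
      by apply: ltW; rewrite -(ltr_pM2l n0) mulrA ns; nra.
    apply: (approximable_pole R T v z (Complex 0 (if 0 <= Im z then 1 else -1)) s) => //.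
      rewrite /cmod /= expr0n add0r sqrtr_sqr.
      by case: ifP => _; rewrite ?normrN normr1.
    move=> w t Tw t0; pose a := z + Complex s 0.
    have Ia : Im a = Im z by rewrite /a ImD /= addr0.
    have Ra : Re a = s by rewrite /a ReD Rz /= add0r.
    have := @gap_ray_dist c s t a (F w); rewrite Ra Ia => /(_ _ t0 _ _ (FT w Tw)).
    rewrite vE /a c0 c1 (_ : F w - _ = F w - Complex s 0 - (z + Complex t 0 *
      Complex 0 (if 0 <= Im z then 1 else -1))); last by ring.
    by apply=> //; lra.
  by apply: eq_approximable => w _; rewrite pE.
have af (e : R[i]) : approximable R T (fun w => (1 + e * v w) ^+ n / sepden R n (v w)).
  apply: approximableM aD; apply: approximableX.
  apply: (approximableD R T (fun=> 1)); first exact: approximable_cst.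
  by apply: (approximableM R T (fun=> e)) => //; exact: approximable_cst.
have near w : T w -> - s < Re (v w) -> Re (v w) <= s -> 3 * (n%:R * cmod (v w)) <= 1.
  move=> Tw; rewrite Rev => lo hi.
  (* The assumption [- s < Re (v w)] means [Re (F w) > 0], so [F w] is in the sector. *)
  have cI : c * `|Im (v w)| <= 2 * s by rewrite Imv; case: (FT w Tw) => Fw; lra.
  have := cmod_le_ReIm _ (v w); rewrite Rev => le1.
  have : `|Re (F w) - s| <= s by rewrite ler_norml; apply/andP; split; lra.
  move=> le2; rewrite -(ler_pM2l c0) mulr1.
  have le3 : c * cmod (v w) <= 3 * s.
    by have := ler_wpM2l (ltW c0) le1; have := ler_wpM2l (ltW c0) le2; nra.
  by have := ler_wpM2l (ltW n0) le3; rewrite [n%:R * (3 * s)]mulrCA ns; lra.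
have K2 (a : R) : n%:R * (2 * a / (1 + B) ^+ 2) = 2 * n%:R * a / K by rewrite /K; ring.
have far w (a : R) : T w -> Re (v w) <= - a -> 0 < a ->
    [/\ sepden R n (v w) != 0,
      cmod ((1 - v w) ^+ n / sepden R n (v w)) <= 1 + (2 * n%:R * a / K)^-1
    & cmod ((1 + v w) ^+ n / sepden R n (v w)) <= (2 * n%:R * a / K)^-1].
  move=> Tw va a0; apply: (sepden_far R _ B); rewrite ?vB//; first by lra.
    by rewrite divr_gt0// mulr_gt0//; lra.
  by rewrite K2 ler_wpM2r ?invr_ge0 ?(ltW K0)// ler_wpM2l//; lra.
have farN w (a : R) : T w -> a <= Re (v w) -> 0 < a ->
    [/\ sepden R n (v w) != 0,
      cmod ((1 + v w) ^+ n / sepden R n (v w)) <= 1 + (2 * n%:R * a / K)^-1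
    & cmod ((1 - v w) ^+ n / sepden R n (v w)) <= (2 * n%:R * a / K)^-1].
  move=> Tw va a0; rewrite -(sepdenN R n (v w)) -{2}[v w]opprK.
  apply: (sepden_far R _ B); rewrite ?cmodN ?vB ?ReN//; first by lra.
    by rewrite divr_gt0// mulr_gt0//; lra.
  by rewrite K2 ler_wpM2r ?invr_ge0 ?(ltW K0)// ler_wpM2l//; lra.
have ys : (2 * n%:R * s / K)^-1 = y0^-1 by rewrite -[2 * _ * s]mulrA ns.
have yi0 : 0 < y0^-1 by rewrite invr_gt0.
have ysg : (2 * n%:R * (sg / 2) / K)^-1 <= tau.
  have nsg0 : 0 < 2 * n%:R * (sg / 2) by rewrite !mulr_gt0 ?invr_gt0 ?ltr0n.
  rewrite -[tau]invrK lef_pV2 ?posrE ?invr_gt0// ?divr_gt0//.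
  by rewrite ler_pdivlMr// [_^-1 * K]mulrC ler_pdivrMr//; lra.
have nzD w : T w -> sepden R n (v w) != 0.
  move=> Tw; have [le1|gt1] := leP (Re (v w)) (- s); first by have [] := far w s Tw le1 s0.
  have [le2|/ltW gt2] := leP (Re (v w)) s; last by have [] := farN w s Tw gt2 s0.
  by have [] := sepden_near R (v w) n (near w Tw gt1 le2).
exists (fun w => (1 - v w) ^+ n / sepden R n (v w)).
exists (fun w => (1 + v w) ^+ n / sepden R n (v w)); split.
- by apply: eq_approximable (af (-1)) => w _; rewrite mulN1r.
- by apply: eq_approximable (af 1) => w _; rewrite mul1r.
- move=> w Tw; have [le1|gt1] := leP (Re (v w)) (- s).
    by have [_] := far w s Tw le1 s0; rewrite ys; lra.
  have [le2|/ltW gt2] := leP (Re (v w)) s.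
    by have [_] := sepden_near R (v w) n (near w Tw gt1 le2); lra.
  by have [_] := farN w s Tw gt2 s0; rewrite ys; lra.
- split=> w Tw Fw.
    by apply: sepden_half; rewrite ?Rev ?nzD//; lra.
  have [||_ _] := far w (sg / 2) Tw; rewrite ?Rev; lra.
- move=> w Tw Fw; split.
    have [||_ _] := farN w (sg / 2) Tw; rewrite ?Rev; lra.
  have := sepden_half R (- v w) n; rewrite sepdenN opprK; apply; last exact: nzD.
  by rewrite ReN Rev; lra.
Qed.


Lemma sector_cmod_le (c : R) (x : R[i]) : 0 < c <= 1 -> c * `|Im x| <= Re x ->
  c * cmod x <= 2 * Re x.
Proof.
move=> /andP[c0 c1] xL; have := ler_wpM2l (ltW c0) (cmod_le_ReIm _ x).
have x0 : 0 <= Re x by apply: le_trans xL; rewrite mulr_ge0 ?(ltW c0).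
by rewrite (ger0_norm x0); nra.
Qed.

(** * Hull of a union whose parts go to a half-plane and a sector *)

Section Union.
Variables (Xa Xb Y : set (C2 R)) (P : {poly {poly R[i]}}) (c : R).
Let X := Xa `|` Xb.
Let F := bieval R P.
Hypothesis bndX : forall Q, bounded_on R X (bieval R Q).
Hypothesis c01 : 0 < c <= 1.
Hypothesis ReXa : forall w, Xa w -> Re (F w) <= 0.
Hypothesis ReXb : forall w, Xb w -> c * `|Im (F w)| <= Re (F w).

Let bndT Q z : poly_hull X z ->
  exists2 M : R, 1 <= M & forall w, (X `|` [set z]) w -> cmod (bieval R Q w) <= M.
Proof.
move=> /poly_hullP Xz; have [M bM] := bndX Q; exists (Num.max M 1).
  by rewrite le_max lexx orbT.
move=> w Tw; rewrite le_max; apply/orP; left.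
by case: Tw => [|->]; [exact: bM|exact: Xz].
Qed.

Let aT Q z : poly_hull X z -> approximable R (X `|` [set z]) (bieval R Q).
Proof.
by move=> /(bndT Q)[M _ bM]; apply: approximable_bieval; exists M.
Qed.

Let FX w : X w -> Re (F w) <= 0 \/ c * `|Im (F w)| <= Re (F w).
Proof. by case=> [/ReXa|/ReXb]; [left|right]. Qed.

Let cmod_unit (b : bool) : cmod (Complex 0 (if b then 1 else -1) : R[i]) = 1.
Proof.
rewrite /cmod /= expr0n add0r sqrtr_sqr.
by case: b; rewrite ?normrN normr1.
Qed.

(* Otherwise a pole placed near [F z], in the gap between the half-plane and the sector,
   gives an approximable function that is larger at [z] than on [X]. *)
Lemma hull_image z : poly_hull X z -> Re (F z) <= 0 \/ c * `|Im (F z)| <= Re (F z).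
Proof.
move=> Xz; apply: contrapT => /not_orP[/negP Rz /negP]; rewrite -!ltNge in Rz * => hz.
have /andP[c0 c1] := c01.
pose d := Num.min (Re (F z)) ((c * `|Im (F z)| - Re (F z)) / 2).
have d0 : 0 < d by rewrite lt_min; apply/andP; split; lra.
have d1 : d <= Re (F z) by rewrite ge_min lexx.
have d2 : d * 2 <= c * `|Im (F z)| - Re (F z).
  by rewrite -ler_pdivlMr// ge_min lexx orbT.
pose u : R[i] := Complex 0 (if 0 <= Im (F z) then 1 else -1).
have u1 : cmod u = 1 by exact: cmod_unit.
pose a := F z + Complex (d / 2) 0 * u.
have aw w (t : R) : X w -> 0 <= t -> d <= cmod (F w - (a + Complex t 0 * u)).
  move=> Xw t0; have d20 : 0 <= d / 2 + t by lra.
  have := gap_ray_dist c d (d / 2 + t) (F z) (F w) c01 d20 d1 d2 (FX _ Xw).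
  rewrite -/u (_ : Complex (d / 2 + t) 0 = Complex (d / 2) 0 + Complex t 0).
    by rewrite mulrDl addrA.
  by apply/eqP; rewrite eq_complex /= addr0 !eqxx.
have az (t : R) : 0 <= t -> cmod (F z - (a + Complex t 0 * u)) = d / 2 + t.
  move=> t0; rewrite /a (_ : _ - _ = - (Complex (d / 2 + t) 0 * u)).
    by rewrite cmodN cmodM u1 mulr1 cmod_real ger0_norm//; lra.
  rewrite (_ : Complex (d / 2 + t) 0 = Complex (d / 2) 0 + Complex t 0); first by ring.
  by apply/eqP; rewrite eq_complex /= addr0 !eqxx.
have C0 : Complex 0 0 = 0 :> R[i] by [].
have apx : approximable R (X `|` [set z]) (fun w => (F w - a)^-1).
  apply: (approximable_pole R _ F a u (d / 2)) (aT P z Xz) _ u1 _; first by lra.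
  by move=> w t [Xw|->] t0; [have := aw w t Xw t0|rewrite az//]; lra.
have := poly_hull_approximable R X z _ d^-1 Xz apx => /(_ _)/negP; apply.
  move=> w Xw; have := aw w 0 Xw (lexx 0); rewrite C0 mul0r addr0 cmodV => le1.
  by rewrite lef_pV2 ?posrE//; lra.
have := az 0 (lexx 0); rewrite C0 mul0r !addr0 cmodV => ->.
by apply/negP; rewrite -ltNge ltf_pV2 ?posrE//; lra.
Qed.

(** The test function is [Q^m] times [- p / (F - p)], with [p] in the gap and close to [0]. The
    second factor is [1] at [z], at most [6 / c] everywhere, and small where [|F| >= sg]. The power
    [m] compensates for [6 / c] near the zero fibre; the smallness of [p] handles the rest. *)
Lemma hull_zero_fiber z Q (sg a : R) : F z = 0 -> 0 < sg -> 0 <= a ->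
  (forall w, X w -> cmod (F w) < sg -> cmod (bieval R Q w) <= a) ->
  a < cmod (bieval R Q z) -> ~ poly_hull X z.
Proof.
move=> Fz0 sg0 a0 Qa ltaQ Xz; have /andP[c0 c1] := c01.
set b := cmod (bieval R Q z) in ltaQ; have b0 : 0 < b by lra.
(* The value [c / 12] is half the inverse of the bound [6 / c]. *)
have [||m lem] := @exists_expr_le R (a / b) (c / 12); [|lra|].
  by rewrite divr_ge0 ?(ltW b0)//= ltr_pdivrMr// mul1r.
rewrite expr_div_n ler_pdivrMr ?exprn_gt0// in lem.
set bm := b ^+ m in lem; have bm0 : 0 < bm by rewrite exprn_gt0.
have [A A1 bA] := bndT (Q ^+ m) z Xz.
(* As [|p| <= 3 t], the first bound gives [|F - p| >= sg / 2] where [|F| >= sg]; the second one then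
   beats the bound [A] of [Q^m]. *)
pose t := Num.min (sg / 6) (sg * bm / (12 * A)).
have t0 : 0 < t.
  by rewrite lt_min !divr_gt0 ?mulr_gt0//; lra.
have t1 : t <= sg / 6 by rewrite ge_min lexx.
have t2 : t * (12 * A) <= sg * bm.
  by rewrite -ler_pdivlMr ?ge_min ?lexx ?orbT//; lra.
have [p Rp Ip] : exists2 p : R[i], Re p = c * t & Im p = 2 * t.
  by exists (Complex (c * t) (2 * t)).
have pd w : (X `|` [set z]) w -> forall r, 0 <= r ->
    c * t / 2 <= cmod (F w - (p + Complex r 0 * Complex 0 (if 0 <= Im p then 1 else -1))).
  move=> Tw r r0; have ct : 0 < c * t by rewrite mulr_gt0.
  apply: (gap_ray_dist c) => //.
  - by rewrite Rp; lra.
  - by rewrite Rp Ip (ger0_norm (_ : 0 <= 2 * t)); lra.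
  - by case: Tw => [/FX//|->]; left; rewrite Fz0.
have pu w : (X `|` [set z]) w -> c * t / 2 <= cmod (F w - p).
  move=> /pd/(_ 0 (lexx 0)).
  by rewrite (_ : Complex 0 0 = 0) ?mul0r ?addr0.
have p3 : cmod p <= 3 * t.
  apply: le_trans (cmod_le_ReIm _ _) _; rewrite Rp Ip.
  have ct : c * t <= t by rewrite ler_piMl ?(ltW t0).
  by rewrite !ger0_norm ?mulr_ge0 ?(ltW c0) ?(ltW t0)//; lra.
have apx : approximable R (X `|` [set z])
    (fun w => bieval R (Q ^+ m) w * (- p * (F w - p)^-1)).
  apply: approximableM; first exact: aT.
  apply: approximableM; first exact: approximable_cst.
  apply: (approximable_pole R _ F p _ (c * t / 2)) (aT P z Xz) _ (cmod_unit (0 <= Im p)) _.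
    by have := mulr_gt0 c0 t0; lra.
  by move=> w r Tw r0; exact: pd.
have ct0 : 0 < c * t by rewrite mulr_gt0.
have := poly_hull_approximable R X z _ (bm / 2) Xz apx => /(_ _)/negP; apply.
  move=> w Xw; have := pu w (or_introl Xw); have := bA w (or_introl Xw).
  rewrite !cmodM cmodV cmodN; have [Fs|Fs] := ltP (cmod (F w)) sg.
    move=> _ le1; have := Qa w Xw Fs => /(fun h => lerXn2r m (cmod_ge0 _ _) a0 h).
    rewrite -cmodX -bievalX; have := cmod_ge0 _ (bieval R (Q ^+ m) w).
    set q := cmod (bieval _ _ _) => q0 qa.
    have fb : cmod p / cmod (F w - p) <= 6 / c.
      rewrite ler_pdivrMr; last by lra.
      have : 6 / c * (c * t / 2) <= 6 / c * cmod (F w - p).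
        by rewrite ler_wpM2l ?divr_ge0 ?(ltW c0).
      by rewrite (_ : 6 / c * (c * t / 2) = 3 * t); [lra|field; rewrite gt_eqF].
    apply: le_trans (_ : (c / 12 * bm) * (6 / c) <= _).
      by rewrite ler_pM// ?divr_ge0 ?cmod_ge0//; lra.
    by rewrite (_ : c / 12 * bm * (6 / c) = bm / 2); [lra|field; rewrite gt_eqF].
  move=> qA le1; have := cmodB_ge _ (F w) p => le2.
  apply: le_trans (_ : A * (6 * t / sg) <= _).
    apply: ler_pM; rewrite ?divr_ge0 ?cmod_ge0// ler_pdivrMr; last by lra.
    rewrite mulrAC ler_pdivlMr// ; nra.
  by rewrite mulrA ler_pdivrMr//; lra.
have np : p != 0 by apply: contraTneq t0 => p0; move: Ip; rewrite p0 /=; lra.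
by apply/negP; rewrite Fz0 sub0r divff ?oppr_eq0// mulr1 bievalX cmodX -/b -/bm -ltNge; lra.
Qed.

Lemma cmod_prod3 (x y z : R[i]) (a b d : R) :
  cmod x <= a -> cmod y <= b -> cmod z <= d -> cmod (x * y * z) <= a * b * d.
Proof.
by move=> xa yb zd; rewrite !cmodM !ler_pM ?mulr_ge0 ?cmod_ge0.
Qed.

(** Otherwise some [Q] is [1] at [z] and tiny on [Xa]. In the product [Q F g], the factor [Q] is
    small on [Xa], [g] is small on [Xb] away from the zeros of [F], and [F] is small on the rest of
    [Xb]; at [z] the product has modulus at least [|F z| / 2]. *)
Lemma hull_left z : poly_hull X z -> F z != 0 -> Re (F z) <= 0 -> poly_hull Xa z.
Proof.
move=> Xz Fz0 Rz; apply: contrapT => nXaz; have /andP[c0 c1] := c01.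
rewrite -cmod_gt0 in Fz0; set f0 := cmod (F z) in Fz0.
have FT w : (X `|` [set z]) w -> Re (F w) <= 0 \/ c * `|Im (F w)| <= Re (F w).
  by case=> [/FX|->]//; left.
have [C' sep] := half_plane_sector_separation _ F c (aT P z Xz) c01 FT.
pose C := Num.max C' 1; have C1 : 1 <= C by rewrite le_max lexx orbT.
have CC : C' <= C by rewrite le_max lexx.
have [M M1 bM] := bndT P z Xz.
have CM : 1 <= C * M by nra.
have [|Q [Qz Qa]] := not_poly_hullP R Xa z (f0 / 4 / (C * M)) _ nXaz.
  by rewrite !divr_gt0//; lra.
have [A A1 bA] := bndT Q z Xz.
have [||g [g' [ag _ bg [gz _] gb]]] :=
  sep (c * (f0 / 8 / (A * C))) (f0 / 4 / (A * M)).
- by rewrite mulr_gt0 ?divr_gt0 ?mulr_gt0//; lra.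
- by rewrite divr_gt0 ?divr_gt0 ?mulr_gt0//; lra.
have apx : approximable R (X `|` [set z]) (fun w => bieval R Q w * F w * g w).
  by apply: approximableM => //; apply: approximableM; exact: aT.
have := poly_hull_approximable R X z _ (f0 / 4) Xz apx => /(_ _)/negP; apply.
  move=> w Xw; have Tw : (X `|` [set z]) w by left.
  have Cw : cmod (g w) <= C by apply: le_trans CC; have [] := bg w Tw.
  have Mw := bM w Tw; have Aw := bA w Tw; case: Xw => [Xw|Xw].
    apply: le_trans (cmod_prod3 _ _ _ _ _ _ (Qa w Xw) Mw Cw) _.
    by rewrite -mulrA (mulrC M) divfK// gt_eqF//; lra.
  have [gw|gw] := leP (c * (f0 / 8 / (A * C))) (Re (F w)).
    have [gt _] := gb w Tw gw.
    apply: le_trans (cmod_prod3 _ _ _ _ _ _ Aw Mw gt) _.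
    by rewrite mulrC divfK// gt_eqF// mulr_gt0//; lra.
  have Fw : cmod (F w) <= f0 / 4 / (A * C).
    rewrite -(ler_pM2l c0); apply: le_trans (sector_cmod_le _ _ c01 (ReXb _ Xw)) _.
    by move: gw; set x := (A * C)^-1; lra.
  apply: le_trans (cmod_prod3 _ _ _ _ _ _ Aw Fw Cw) _.
  by rewrite mulrAC mulrC divfK// gt_eqF// mulr_gt0//; lra.
apply/negP; rewrite -ltNge Qz mul1r cmodM -/f0.
by have := gz z (or_intror erefl) Rz; nra.
Qed.

(** Mirror image of [hull_left]. The function for the sector is small only where [Re F] is at most a
    negative constant, so [F] must send [Xa] strictly into the half-plane off [0]. *)
Lemma hull_right z :
  (forall sg : R, 0 < sg -> exists2 sg' : R, 0 < sg' &
     forall w, Xa w -> sg <= cmod (F w) -> Re (F w) <= - sg') ->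
  poly_hull X z -> 0 < Re (F z) -> c * `|Im (F z)| <= Re (F z) -> poly_hull Xb z.
Proof.
move=> strict Xz Rz cz; apply: contrapT => nXbz; have /andP[c0 c1] := c01.
have Fz0 : 0 < cmod (F z).
  by apply: lt_le_trans Rz _; apply: le_trans (ler_norm _) (normr_Re_le _ _).
set f0 := cmod (F z) in Fz0.
have FT w : (X `|` [set z]) w -> Re (F w) <= 0 \/ c * `|Im (F w)| <= Re (F w).
  by case=> [/FX|->]//; right.
have [C' sep] := half_plane_sector_separation _ F c (aT P z Xz) c01 FT.
pose C := Num.max C' 1; have C1 : 1 <= C by rewrite le_max lexx orbT.
have CC : C' <= C by rewrite le_max lexx.
have [M M1 bM] := bndT P z Xz.
have CM : 1 <= C * M by nra.
have [|Q [Qz Qb]] := not_poly_hullP R Xb z (f0 / 4 / (C * M)) _ nXbz.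
  by rewrite !divr_gt0//; lra.
have [A A1 bA] := bndT Q z Xz.
have [|s s0 sXa] := strict (f0 / 4 / (A * C)).
  by rewrite divr_gt0 ?divr_gt0 ?mulr_gt0//; lra.
(* The threshold is also at most [Re (F z)], so that [g] is bounded below at [z]. *)
have [||g' [g [_ ag bg [_ ga] gz]]] :=
  sep (Num.min s (Re (F z))) (f0 / 4 / (A * M)).
- by rewrite lt_min s0.
- by rewrite divr_gt0 ?divr_gt0 ?mulr_gt0//; lra.
have apx : approximable R (X `|` [set z]) (fun w => bieval R Q w * F w * g w).
  by apply: approximableM => //; apply: approximableM; exact: aT.
have := poly_hull_approximable R X z _ (f0 / 4) Xz apx => /(_ _)/negP; apply.
  move=> w Xw; have Tw : (X `|` [set z]) w by left.
  have Cw : cmod (g w) <= C by apply: le_trans CC; have [] := bg w Tw.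
  have Mw := bM w Tw; have Aw := bA w Tw; case: Xw => [Xw|Xw]; last first.
    apply: le_trans (cmod_prod3 _ _ _ _ _ _ (Qb w Xw) Mw Cw) _.
    by rewrite -mulrA (mulrC M) divfK// gt_eqF//; lra.
  have [gw|/ltW Fw] := leP (f0 / 4 / (A * C)) (cmod (F w)).
    have gt : cmod (g w) <= f0 / 4 / (A * M).
      apply: ga => //; apply: le_trans (sXa w Xw gw) _.
      by rewrite lerN2 ge_min lexx.
    apply: le_trans (cmod_prod3 _ _ _ _ _ _ Aw Mw gt) _.
    by rewrite mulrC divfK// gt_eqF// mulr_gt0//; lra.
  apply: le_trans (cmod_prod3 _ _ _ _ _ _ Aw Fw Cw) _.
  by rewrite mulrAC mulrC divfK// gt_eqF// mulr_gt0//; lra.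
apply/negP; rewrite -ltNge Qz mul1r cmodM -/f0.
have le1 : Num.min s (Re (F z)) <= Re (F z) by rewrite ge_min lexx orbT.
by have [_] := gz z (or_intror erefl) le1; nra.
Qed.

End Union.
End Kallin.

(** * Balls, dilations and real cones *)

Section Balls.
Variable R : realType.
Implicit Types (z w : C2 R) (r : R) (K E : set (C2 R)).

Lemma cball2_0E r w : cball2 0 r w = (cmod (coord1 w) ^+ 2 + cmod (coord2 w) ^+ 2 <= r ^+ 2).
Proof. by rewrite /cball2 /= /coord1 /coord2 !mxE !subr0. Qed.

Lemma cball2_coord r w : 0 <= r -> cball2 0 r w ->
  cmod (coord1 w) <= r /\ cmod (coord2 w) <= r.
Proof.
rewrite cball2_0E => r0 rw; have := sqr_ge0 (cmod (coord1 w)).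
have := sqr_ge0 (cmod (coord2 w)) => ? ?.
by split; rewrite -ler_sqr ?nnegrE ?cmod_ge0//; lra.
Qed.

Lemma bounded_bieval_cball2 r P : 0 <= r -> bounded_on R (cball2 0 r) (bieval R P).
Proof.
move=> r0; have [n [c PE]] := bievalP R P.
exists (\sum_(i < n) \sum_(j < n) cmod (c i j) * r ^+ i * r ^+ j) => w.
move=> /(cball2_coord _ _ r0)[r1 r2]; rewrite PE.
apply: le_trans (cmod_sum_le _ _ _ _) _; apply: ler_sum => i _.
apply: le_trans (cmod_sum_le _ _ _ _) _; apply: ler_sum => j _.
rewrite !cmodM !cmodX; apply: ler_pM; rewrite ?mulr_ge0 ?exprn_ge0 ?cmod_ge0//.
  by rewrite ler_wpM2l ?cmod_ge0// lerXn2r ?nnegrE ?cmod_ge0.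
by rewrite lerXn2r ?nnegrE ?cmod_ge0.
Qed.

(* Cauchy-Schwarz for the polynomial [w |-> <w, z>]. *)
Lemma poly_hull_cball2 r K : 0 <= r -> K `<=` cball2 0 r -> poly_hull K `<=` cball2 0 r.
Proof.
move=> r0 Kr z /poly_hullP Kz; rewrite cball2_0E.
pose cj (x : R[i]) := Complex (Re x) (- Im x).
have cjE x : cmod (cj x) = cmod x.
  apply/eqP; rewrite -(@eqrXn2 _ 2) ?cmod_ge0// !sqr_cmod /= sqrrN//.
have cjM x : cj x * x = Complex (cmod x ^+ 2) 0.
  rewrite sqr_cmod; apply/eqP; rewrite eq_complex ReM ImM /=.
  by apply/andP; split; apply/eqP; ring.
set N := _ + _; have N0 : 0 <= N by rewrite addr_ge0 ?exprn_ge0 ?cmod_ge0.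
have := Kz ((cj (coord1 z))%:P%:P * 'X%:P + (cj (coord2 z))%:P%:P * 'X) (Num.sqrt N * r).
rewrite bievalD !bievalM !bievalC bieval_coord1 bieval_coord2 !cjM.
rewrite (_ : _ + _ = Complex N 0); last by apply/eqP; rewrite eq_complex /= addr0 !eqxx.
rewrite cmod_real (ger0_norm N0) => Kz'; have {Kz'} le1 : N <= Num.sqrt N * r.
  apply: Kz' => w /Kr; rewrite cball2_0E bievalD !bievalM !bievalC bieval_coord1 bieval_coord2 => rw.
  apply: le_trans (cmodD_le _ _ _) _; rewrite !cmodM !cjE.
  rewrite -ler_sqr ?nnegrE ?addr_ge0 ?mulr_ge0 ?sqrtr_ge0 ?cmod_ge0//.
  rewrite exprMn sqr_sqrtr//; apply: le_trans (ler_wpM2l N0 rw); rewrite /N.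
  set a := cmod _; set b := cmod (coord1 w); set a' := cmod _; set b' := cmod _.
  by have := sqr_ge0 (a * b' - a' * b); lra.
have [->|nzN] := eqVneq N 0; first exact: sqr_ge0.
have N1 : 0 < Num.sqrt N by rewrite sqrtr_gt0 lt_neqAle eq_sym nzN.
move: le1; rewrite -{1}(sqr_sqrtr N0) expr2 ler_pM2l// => le1.
by rewrite -(sqr_sqrtr N0) lerXn2r ?nnegrE ?sqrtr_ge0.
Qed.

Definition real_cone E := forall (t : R) w, 0 < t -> E w -> E (Complex t 0 *: w).

Lemma coordZ (c : R[i]) w :
  (coord1 (c *: w) = c * coord1 w) * (coord2 (c *: w) = c * coord2 w).
Proof. by rewrite /coord1 /coord2 !mxE. Qed.

Lemma cball2Z t r w : 0 < t -> cball2 0 (t * r) (Complex t 0 *: w) <-> cball2 0 r w.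
Proof.
move=> t0; rewrite !cball2_0E !coordZ !cmodM cmod_real (gtr0_norm t0) !exprMn -mulrDr.
by rewrite ler_pM2l// exprn_gt0.
Qed.

Lemma bieval_scale P (c : R[i]) :
  exists P', forall w, bieval R P' w = bieval R P (c *: w).
Proof.
have [n [k PE]] := bievalP R P.
exists (\sum_(i < n) \sum_(j < n)
  (k i j)%:P%:P * (c%:P%:P * 'X%:P) ^+ i * (c%:P%:P * 'X) ^+ j) => w.
rewrite PE bieval_sum; apply: eq_bigr => i _.
rewrite bieval_sum; apply: eq_bigr => j _.
by rewrite !bievalM !bievalX !bievalM !bievalC bieval_coord1 bieval_coord2 !coordZ.
Qed.

(** Composing polynomials with a dilation, which preserves the cone, transports one radius to the
    other. The different radii in the hypotheses can thus all become [1]. *)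
Lemma poly_convex_scale E r r' : real_cone E -> 0 < r -> 0 < r' ->
  poly_convex (E `&` cball2 0 r) -> poly_convex (E `&` cball2 0 r').
Proof.
move=> coneE r0 r'0 pcE z Ez; pose t := r / r'; have t0 : 0 < t by rewrite divr_gt0.
have tr : t * r' = r by rewrite divfK// gt_eqF.
have : poly_hull (E `&` cball2 0 r) (Complex t 0 *: z).
  apply/poly_hullP => P M bndP; have [P' P'E] := bieval_scale P (Complex t 0).
  rewrite -P'E; apply: (iffLR (poly_hullP _ _ _) Ez) => w [Ew rw].
  rewrite P'E; apply: bndP; split; first exact: coneE.
  by rewrite -tr; apply/cball2Z.
move=> /pcE[Etz]; rewrite -tr => /(cball2Z _ _ _ t0) rz; split=> //.
have -> : z = Complex t^-1 0 *: (Complex t 0 *: z).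
  rewrite scalerA (_ : _ * _ = 1) ?scale1r//; apply/eqP.
  rewrite eq_complex ReM ImM /=; apply/andP; split; apply/eqP; last by ring.
  by rewrite mulr0 subr0 mulVf ?gt_eqF.
by apply: coneE; rewrite ?invr_gt0.
Qed.

Lemma real_plane_cone E : real_plane E -> real_cone E.
Proof.
case=> u [v [_ ->]] t w t0 [a [b ->]]; exists (t * a), (t * b).
by rewrite scalerDr !scalerA !(rmorphM (real_complex R)).
Qed.

Lemma real_coneU E E' : real_cone E -> real_cone E' -> real_cone (E `|` E').
Proof.
by move=> cE cE' t w t0 [Ew|Ew]; [left; exact: cE|right; exact: cE'].
Qed.

End Balls.

(** * Bending the half-plane and the sector *)

Section Bending.
Variables (R : realType) (c M : R).
Hypotheses (c01 : 0 < c <= 1) (M0 : 0 < M).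
Implicit Type x : R[i].

(* Bending by a small multiple of the square moves the imaginary axis strictly into the left
   half-plane, away from [0]. *)
Definition bend x := x + Complex (c / (2 * M)) 0 * x ^+ 2.

Let k0 : 0 < c / (2 * M).
Proof. by have /andP[c0 _] := c01; rewrite divr_gt0// mulr_gt0. Qed.

Let kM : c / (2 * M) * M = c / 2.
Proof. by field; rewrite gt_eqF. Qed.

Lemma Re_bend x : Re (bend x) = Re x + c / (2 * M) * (Re x ^+ 2 - Im x ^+ 2).
Proof. by rewrite /bend ReD ReM expr2 ReM ImM /=; ring. Qed.

Lemma Im_bend x : Im (bend x) = Im x + c / (2 * M) * (2 * Re x * Im x).
Proof. by rewrite /bend ImD ImM expr2 ReM ImM /=; ring. Qed.

(** For [|x| <= M] the quadratic term has modulus at most [c / 2 <= 1 / 2] times [|x|]. *)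
Lemma cmod_bend x : cmod x <= M ->
  cmod x <= 2 * cmod (bend x) /\ cmod (bend x) <= 2 * cmod x.
Proof.
move=> xM; have /andP[c0 c1] := c01.
have := cmodD_ge _ x (Complex (c / (2 * M)) 0 * x ^+ 2).
have := cmodD_le _ x (Complex (c / (2 * M)) 0 * x ^+ 2).
rewrite -/(bend x) cmodM cmod_real (gtr0_norm k0) cmodX.
have : c / (2 * M) * cmod x ^+ 2 <= c / 2 * cmod x.
  rewrite -kM expr2 -[leRHS]mulrA ler_wpM2l ?(ltW k0)//.
  by rewrite ler_wpM2r// cmod_ge0.
have := cmod_ge0 _ x; nra.
Qed.

(** With [k = c / (2 M)], the real part is [Re x + 2 k (Re x)^2 - k |x|^2], and
    [2 k (Re x)^2 <= - c Re x <= - Re x]. *)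
Lemma Re_bend_half_plane x : cmod x <= M -> Re x <= 0 ->
  Re (bend x) <= - (c / (2 * M) * cmod x ^+ 2).
Proof.
move=> xM x0; rewrite Re_bend sqr_cmod; have /andP[c0 c1] := c01.
have := normr_Re_le _ x; rewrite ler0_norm// => le1.
have : c / (2 * M) * (Re x ^+ 2) <= c / 2 * - Re x.
  by rewrite -kM -sqrrN expr2 -[leRHS]mulrA ler_wpM2l ?(ltW k0)// ler_wpM2r//; lra.
set k := c / _; nra.
Qed.

(** Bending at most doubles [|Im x|] and keeps at least half of [Re x], so the constant drops from
    [c] to [c / 4]. *)
Lemma Re_bend_sector x : cmod x <= M -> c * `|Im x| <= Re x ->
  c / 4 * `|Im (bend x)| <= Re (bend x).
Proof.
move=> xM xL; have /andP[c0 c1] := c01.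
have x0 : 0 <= Re x by apply: le_trans xL; rewrite mulr_ge0 ?(ltW c0).
have := normr_Re_le _ x; rewrite ger0_norm// => le1.
have := normr_Im_le _ x => le2; have I0 := normr_ge0 (Im x).
have kI : c / (2 * M) * Im x ^+ 2 <= 2^-1 * Re x.
  rewrite -real_normK ?num_real//.
  have : c / (2 * M) * (`|Im x| ^+ 2) <= c / 2 * `|Im x|.
    by rewrite -kM expr2 -[leRHS]mulrA ler_wpM2l ?(ltW k0)// ler_wpM2r//; lra.
  by lra.
have le3 : `|Im (bend x)| <= 2 * `|Im x|.
  rewrite Im_bend (_ : _ + _ = (1 + c / (2 * M) * Re x * 2) * Im x); last by ring.
  have kR : c / (2 * M) * Re x <= c / 2.
    by rewrite -kM ler_wpM2l ?(ltW k0)//; lra.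
  have kR0 : 0 <= c / (2 * M) * Re x by rewrite mulr_ge0 ?(ltW k0).
  by rewrite normrM ger0_norm ?ler_wpM2r//; lra.
rewrite Re_bend.
have : 0 <= c / (2 * M) * Re x ^+ 2 by rewrite mulr_ge0 ?(ltW k0) ?sqr_ge0.
by have := ler_wpM2l (ltW c0) le3; lra.
Qed.

End Bending.

(** * Convexity of a union from a separating polynomial *)

Section Planes.
Variable R : realType.
Implicit Types (z w : C2 R) (P Q : {poly {poly R[i]}}).

(** [Y1] and [Y2] are coordinates in which [P0] is the real plane. The last bounds on them say that
    [Q] is small on [X] off [P0] only near their common zero, so that only [P0] counts in the zero
    fibre of [Q]. *)
Lemma poly_convex_union (r e c : R) (P0 X Xa Xb : set (C2 R)) Q Y1 Y2 :
  0 < r -> e ^+ 2 = 1 -> 0 < c <= 1 ->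
  (forall w, P0 w <-> Im (bieval R Y1 w) = 0 /\ Im (bieval R Y2 w) = 0) ->
  P0 0 -> bieval R Y1 0 = 0 -> bieval R Y2 0 = 0 ->
  X = Xa `|` Xb -> X `<=` cball2 0 r -> P0 `&` cball2 0 r `<=` X ->
  (forall w, Xa w -> e * Im (bieval R Q w) <= 0) ->
  (forall w, Xb w -> c * `|Re (bieval R Q w)| <= e * Im (bieval R Q w)) ->
  (forall w, X w -> P0 w \/ (c * cmod (bieval R Y1 w) ^+ 2 <= cmod (bieval R Q w) /\
                             c * cmod (bieval R Y2 w) ^+ 2 <= cmod (bieval R Q w))) ->
  poly_hull Xa `<=` X -> poly_hull Xb `<=` X -> poly_convex X.
Proof.
move=> r0 e1 c01 P0P P00 Y10 Y20 XE Xr P0X Qa Qb QY hXa hXb z Xz.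
have /andP[c0 c1] := c01; have rz := poly_hull_cball2 R r X (ltW r0) Xr z Xz.
have bnd P : exists2 M : R, 1 <= M & forall w, cball2 0 r w -> cmod (bieval R P w) <= M.
  have [M bM] := bounded_bieval_cball2 R r P (ltW r0); exists (Num.max M 1).
    by rewrite le_max lexx orbT.
  by move=> w /bM; rewrite le_max => ->.
have [M M1 bM] := bnd Q.
have M0 : 0 < M by lra.
(* The factor [- i e] turns [e Im Q] into a real part; [P] below is the bending of [tau] written as
   a polynomial. *)
pose tau w := Complex 0 (- e) * bieval R Q w.
have Ret w : Re (tau w) = e * Im (bieval R Q w) by rewrite ReM /=; ring.
have Imt w : Im (tau w) = - (e * Re (bieval R Q w)) by rewrite ImM /=; ring.
have ne1 : `|e| = 1 by apply/eqP; rewrite -(@eqrXn2 _ 2)// real_normK ?num_real// e1 expr1n.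
have cmt w : cmod (tau w) = cmod (bieval R Q w).
  by rewrite cmodM /cmod /= expr0n add0r sqrtr_sqr normrN ne1 mul1r.
pose B := (Complex 0 (- e))%:P%:P * Q.
pose P := B + (Complex (c / (2 * M)) 0)%:P%:P * B ^+ 2.
have PE w : bieval R P w = bend R c M (tau w).
  have BE : bieval R B w = tau w by rewrite bievalM bievalC.
  by rewrite bievalD [X in _ + X]bievalM bievalX BE bievalC.
have tM w : cball2 0 r w -> cmod (tau w) <= M by rewrite cmt; exact: bM.
rewrite XE in Xr Xz QY *; rewrite -XE in hXa hXb *.
have c4 : 0 < c / 4 <= 1 by apply/andP; split; lra.
have bX S : bounded_on R (Xa `|` Xb) (bieval R S).
  by have [N _ bN] := bnd S; exists N => w /Xr/bN.
have FXa w : Xa w -> Re (bieval R P w) <= 0.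
  move=> Xw; rewrite PE; apply: le_trans (Re_bend_half_plane _ _ _ c01 M0 _ _ _) _.
  - by apply: tM; apply: Xr; left.
  - by rewrite Ret Qa.
  - by rewrite oppr_le0 mulr_ge0 ?divr_ge0 ?exprn_ge0 ?cmod_ge0//; lra.
have FXb w : Xb w -> c / 4 * `|Im (bieval R P w)| <= Re (bieval R P w).
  move=> Xw; rewrite PE; apply: Re_bend_sector => //.
    by apply: tM; apply: Xr; right.
  by rewrite Ret Imt normrN normrM ne1 mul1r Qb.
have [Pz0|Pz0] := eqVneq (bieval R P z) 0; last first.
  have [Rz|Rz] := leP (Re (bieval R P z)) 0.
    exact/hXa/(hull_left R Xa Xb P (c / 4) bX c4 FXa FXb z Xz Pz0 Rz).
  apply/hXb/(hull_right R Xa Xb P (c / 4) bX c4 FXa FXb z _ Xz Rz).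
    (* Since [|bend x| <= 2 |x|], a bent value of modulus at least [sg] comes from
       [|x| >= sg / 2]. *)
    move=> sg sg0; exists (c / (2 * M) * (sg / 2) ^+ 2).
      by rewrite mulr_gt0 ?divr_gt0 ?exprn_gt0 ?mulr_gt0 ?divr_gt0//; lra.
    move=> w Xw; rewrite PE => sgw; have tw : cmod (tau w) <= M by apply: tM; apply: Xr; left.
    apply: le_trans (Re_bend_half_plane _ _ _ c01 M0 _ tw _) _; first by rewrite Ret Qa.
    have [_ le1] := cmod_bend _ _ _ c01 M0 _ tw.
    rewrite lerN2 ler_wpM2l ?divr_ge0//; try lra.
    by rewrite lerXn2r ?nnegrE ?cmod_ge0//; lra.
  have [|//] := hull_image R Xa Xb P (c / 4) bX c4 FXa FXb z Xz.
  by lra.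
have [P0z|nP0z] := pselect (P0 z); first exact: P0X.
exfalso; move: Xz.
have [N1 N11 bN1] := bnd Y1; have [N2 N21 bN2] := bnd Y2.
have y1z := bN1 z rz; have y2z := bN2 z rz.
pose a1 := Re (bieval R Y1 z); pose a2 := Re (bieval R Y2 z).
pose b1 := Im (bieval R Y1 z); pose b2 := Im (bieval R Y2 z).
have a1N : `|a1| <= N1 := le_trans (normr_Re_le _ _) y1z.
have a2N : `|a2| <= N2 := le_trans (normr_Re_le _ _) y2z.
pose be := b1 ^+ 2 + b2 ^+ 2.
have be0 : 0 < be.
  rewrite lt_neqAle addr_ge0 ?sqr_ge0// andbT eq_sym; apply: contra_notN nP0z.
  by rewrite paddr_eq0 ?sqr_ge0// !sqrf_eq0 => /andP[/eqP ? /eqP ?]; apply/P0P.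
(* On [P0] in the ball, [Y1] and [Y2] are real and within [2 N1] and [2 N2] of [a1] and [a2], so
   [0 <= S <= D]. At [z] the differences are [i b1] and [i b2], whence [S = D + be]. *)
pose D := (2 * N1) ^+ 2 + (2 * N2) ^+ 2.
have D0 : 0 < D by rewrite addr_gt0 ?exprn_gt0//; lra.
pose S : {poly {poly R[i]}} := (Complex D 0)%:P%:P
  - (Y1 - (Complex a1 0)%:P%:P) ^+ 2 - (Y2 - (Complex a2 0)%:P%:P) ^+ 2.
have SE w : bieval R S w = Complex D 0 - (bieval R Y1 w - Complex a1 0) ^+ 2
    - (bieval R Y2 w - Complex a2 0) ^+ 2.
  by rewrite 2!bievalB 2!bievalX 2!bievalB 3!bievalC.
have Sreal w : P0 w -> cball2 0 r w -> cmod (bieval R S w) <= D.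
  move=> /P0P[I1 I2] rw; rewrite SE.
  have y1w := bN1 w rw; have y2w := bN2 w rw.
  have E1 : bieval R Y1 w = Complex (Re (bieval R Y1 w)) 0.
    by apply/eqP; rewrite eq_complex /= I1 !eqxx.
  have E2 : bieval R Y2 w = Complex (Re (bieval R Y2 w)) 0.
    by apply/eqP; rewrite eq_complex /= I2 !eqxx.
  have x1N := le_trans (normr_Re_le _ _) y1w; have x2N := le_trans (normr_Re_le _ _) y2w.
  set x1 := Re (bieval R Y1 w) in E1 x1N; set x2 := Re (bieval R Y2 w) in E2 x2N.
  rewrite E1 E2.
  rewrite (_ : _ - _ = Complex (D - (x1 - a1) ^+ 2 - (x2 - a2) ^+ 2) 0); last first.
    by apply/eqP; rewrite eq_complex !expr2 !ReD !ReN !ImD !ImN !ReM !ImM /=;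
       apply/andP; split; apply/eqP; ring.
  have sq (x a N : R) : `|x| <= N -> `|a| <= N -> (x - a) ^+ 2 <= (2 * N) ^+ 2.
    move=> xN aN; rewrite -real_normK ?num_real// lerXn2r ?nnegrE//.
      by have := normr_ge0 x; lra.
    by have := ler_normB x a; lra.
  have := sq _ _ _ x1N a1N; have := sq _ _ _ x2N a2N.
  rewrite cmod_real ler_norml => le2 le1.
  by have := sqr_ge0 (x1 - a1); have := sqr_ge0 (x2 - a2); rewrite /D; lra.
have Sz : bieval R S z = Complex (D + be) 0.
  rewrite SE /a1 /a2 /be /b1 /b2; case: (bieval R Y1 z) (bieval R Y2 z) => [x1 y1] [x2 y2].
  by apply/eqP; rewrite eq_complex !expr2 !ReD !ReN !ImD !ImN !ReM !ImM /=;
     apply/andP; split; apply/eqP; ring.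
(* Where [|Y1|] and [|Y2|] are at most [d], [S] differs from its value at [0] by at most
   [d A <= be / 2]. *)
pose A := 2 + 2 * `|a1| + 2 * `|a2|.
have A0 : 0 < A by rewrite /A; have := normr_ge0 a1; have := normr_ge0 a2; lra.
pose d := Num.min 1 (be / 2 / A).
have d0 : 0 < d by rewrite lt_min ltr01 !divr_gt0.
have d1 : d <= 1 by rewrite ge_min lexx.
have dA : d * A <= be / 2 by rewrite -ler_pdivlMr// ge_min lexx orbT.
(* Bending at most halves the modulus, so [|P| < c d^2 / 2] gives [|Q| <= c d^2], hence
   [|Y1|, |Y2| <= d] off [P0]. *)
apply: (hull_zero_fiber R Xa Xb P (c / 4) bX c4 FXa FXb z S (c * d ^+ 2 / 2) (D + be / 2)) => //.
- by rewrite divr_gt0 ?mulr_gt0 ?exprn_gt0.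
- by lra.
- move=> w Xw; rewrite PE => ltw; case: (QY w Xw) => [P0w|[q1 q2]].
    by have := Sreal w P0w (Xr _ Xw); lra.
  have [le1 _] := cmod_bend _ _ _ c01 M0 _ (tM w (Xr _ Xw)); rewrite cmt in le1.
  have yd y : c * cmod y ^+ 2 <= cmod (bieval R Q w) -> cmod y <= d.
    move=> qy; rewrite -ler_sqr ?nnegrE ?cmod_ge0 ?(ltW d0)//.
    by rewrite -(ler_pM2l c0); lra.
  have {}q1 := yd _ q1; have {}q2 := yd _ q2.
  have S0 := Sreal 0 P00 (_ : cball2 0 r 0); rewrite SE Y10 Y20 in S0.
  rewrite SE; set y1 := bieval R Y1 w in q1 *; set y2 := bieval R Y2 w in q2 *.
  have -> : Complex D 0 - (y1 - Complex a1 0) ^+ 2 - (y2 - Complex a2 0) ^+ 2 =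
     (Complex D 0 - (0 - Complex a1 0) ^+ 2 - (0 - Complex a2 0) ^+ 2)
     + ((Complex (a1 + a1) 0 - y1) * y1 + (Complex (a2 + a2) 0 - y2) * y2).
    have C2 a : Complex (a + a) 0 = Complex a 0 + Complex a 0 :> R[i].
      by apply/eqP; rewrite eq_complex /= addr0 !eqxx.
    by rewrite !C2; ring.
  have yb y (a : R) : cmod y <= d -> cmod ((Complex (a + a) 0 - y) * y) <= (2 * `|a| + 1) * d.
    move=> yd'; rewrite cmodM ler_pM ?cmod_ge0//.
    apply: le_trans (cmodB_le _ _ _) _; rewrite cmod_real.
    by have := ler_normD a a; lra.
  have := cmodD_le _ ((Complex (a1 + a1) 0 - y1) * y1) ((Complex (a2 + a2) 0 - y2) * y2).
  have := yb _ a1 q1; have := yb _ a2 q2 => h1 h2 h3.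
  apply: le_trans (cmodD_le _ _ _) _; rewrite /A in dA; apply: lerD; last by lra.
  by apply: S0; rewrite cball2_0E /coord1 /coord2 !mxE !cmod0 !expr0n /= addr0 sqr_ge0.
- by rewrite Sz cmod_real ger0_norm; lra.
Qed.

End Planes.

(** * Real quadratic forms and their complexification *)

Section QuadraticForms.
Variable R : realType.

(** The constant is determinant over trace. By Cayley-Hamilton, [tr S (x^T S x) - det S |x|^2 = |S
    x|^2 >= 0]. *)
Lemma definite_form_ge (a b d : R) : 0 < a -> 0 < a * d - b ^+ 2 ->
  exists2 k : R, 0 < k &
    forall x y, k * (x ^+ 2 + y ^+ 2) <= a * x ^+ 2 + 2 * b * x * y + d * y ^+ 2.
Proof.
move=> a0 D0; have d0 : 0 < d by rewrite -(pmulr_rgt0 _ a0); have := sqr_ge0 b; lra.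
have t0 : 0 < a + d by lra.
exists ((a * d - b ^+ 2) / (a + d)); first by rewrite divr_gt0.
move=> x y; rewrite -(ler_pM2l t0) mulrA mulrCA mulfV ?gt_eqF// mulr1.
by have := sqr_ge0 (a * x + b * y); have := sqr_ge0 (b * x + d * y); nra.
Qed.

Lemma definite_form_sign (a b d : R) : 0 < a * d - b ^+ 2 ->
  exists e k : R, [/\ e ^+ 2 = 1, 0 < k &
    forall x y, k * (x ^+ 2 + y ^+ 2) <= e * (a * x ^+ 2 + 2 * b * x * y + d * y ^+ 2)].
Proof.
move=> D0; have [a0|a0|a0] := ltgtP a 0.
- have [||k k0 le1] := @definite_form_ge (- a) (- b) (- d); [lra|lra|].
  by exists (-1), k; split=> // [|x y]; [ring|have := le1 x y; lra].
- have [k k0 le1] := definite_form_ge _ _ _ a0 D0.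
  by exists 1, k; split=> // [|x y]; [ring|have := le1 x y; lra].
- by have := sqr_ge0 b; rewrite a0 in D0; lra.
Qed.

Lemma form_le (a b d x y : R) :
  `|a * x ^+ 2 + b * x * y + d * y ^+ 2| <= (`|a| + `|b| + `|d|) * (x ^+ 2 + y ^+ 2).
Proof.
have xy : `|x * y| <= x ^+ 2 + y ^+ 2.
  by rewrite ler_norml; have := sqr_ge0 (x + y); have := sqr_ge0 (x - y); nra.
apply: le_trans (ler_normD _ _) _; apply: le_trans (lerD (ler_normD _ _) (lexx _)) _.
rewrite -[b * x * y]mulrA (normrM a) (normrM b) (normrM d) !(ger0_norm (sqr_ge0 _)).
have := ler_wpM2l (normr_ge0 b) xy.
have := mulr_ge0 (normr_ge0 a) (sqr_ge0 y); have := mulr_ge0 (normr_ge0 d) (sqr_ge0 x).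
by lra.
Qed.

(** This is [y^T S y], without conjugation and hence holomorphic, for the symmetric [S] with rows
    [(s1, s2)] and [(s2, s3)]. *)
Definition qform (s1 s2 s3 : R) (y1 y2 : R[i]) : R[i] :=
  Complex s1 0 * y1 ^+ 2 + Complex (2 * s2) 0 * (y1 * y2) + Complex s3 0 * y2 ^+ 2.

(* The imaginary part of the form on [(A + i) R^2] is twice the form of the symmetric
   matrix [S A]. *)
Lemma qform_sector (s1 s2 s3 a b c d : R) :
  s1 * b + s2 * d = s2 * a + s3 * c ->
  0 < (s1 * s3 - s2 ^+ 2) * (a * d - b * c) ->
  exists e k : R, [/\ e ^+ 2 = 1, 0 < k <= 1 & forall x1 x2 : R,
    let y1 := Complex (a * x1 + b * x2) x1 in let y2 := Complex (c * x1 + d * x2) x2 in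
    let q := qform s1 s2 s3 y1 y2 in
    [/\ k * `|Re q| <= e * Im q, k * cmod y1 ^+ 2 <= e * Im q
      & k * cmod y2 ^+ 2 <= e * Im q]].
Proof.
move=> sym D0.
have [|e [k [e1 k0 lek]]] :=
  @definite_form_sign (s1 * a + s2 * c) (s1 * b + s2 * d) (s2 * b + s3 * d).
  (* By the symmetry of [S A], this is [det (S A) = det S det A]. *)
  rewrite expr2 {2}sym (_ : _ - _ = (s1 * s3 - s2 ^+ 2) * (a * d - b * c))//; ring.
pose fm (x y z : R) := `|x| + `|y| + `|z|.
have fm0 x y z : 0 <= fm x y z by rewrite /fm !addr_ge0.
(* Coefficients of [Re q], that is of [(A x)^T S (A x) - x^T S x]; [K] dominates this form as well
   as [|y1|^2] and [|y2|^2]. *)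
pose r1 := s1 * (a ^+ 2 - 1) + 2 * s2 * (a * c) + s3 * c ^+ 2.
pose r2 := s1 * (2 * a * b) + 2 * s2 * (a * d + b * c - 1) + s3 * (2 * c * d).
pose r3 := s1 * b ^+ 2 + 2 * s2 * (b * d) + s3 * (d ^+ 2 - 1).
pose K := fm r1 r2 r3 + fm (a ^+ 2 + 1) (2 * a * b) (b ^+ 2)
  + fm (c ^+ 2) (2 * c * d) (d ^+ 2 + 1).
have K0 : 0 <= K by rewrite /K !addr_ge0.
pose m := Num.min 1 (k / (K + 1)).
have m0 : 0 < m by rewrite lt_min ltr01 divr_gt0//; lra.
have mK : m * (K + 1) <= k by rewrite -ler_pdivlMr ?ge_min ?lexx ?orbT//; lra.
exists e, m; split; rewrite ?m0 ?ge_min ?lexx// => x1 x2 y1 y2 q.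
have Iq : e * Im q = 2 * (e * ((s1 * a + s2 * c) * x1 ^+ 2
    + 2 * (s1 * b + s2 * d) * x1 * x2 + (s2 * b + s3 * d) * x2 ^+ 2)).
  rewrite (_ : 2 * (s1 * b + s2 * d) = (s1 * b + s2 * d) + (s2 * a + s3 * c)); last by lra.
  by rewrite /q /qform !expr2 !(ImD, ImM, ReM) /=; ring.
have bound (x al be ga : R) : x = al * x1 ^+ 2 + be * x1 * x2 + ga * x2 ^+ 2 ->
    fm al be ga <= K -> m * `|x| <= e * Im q.
  move=> -> leK; rewrite Iq; have := lek x1 x2; set E := e * _ => le1.
  have N0 : 0 <= x1 ^+ 2 + x2 ^+ 2 by rewrite addr_ge0 ?sqr_ge0.
  apply: le_trans (ler_wpM2l (ltW m0) (form_le _ _ _ _ _)) _.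
  have : fm al be ga * (x1 ^+ 2 + x2 ^+ 2) <= (K + 1) * (x1 ^+ 2 + x2 ^+ 2).
    by rewrite ler_wpM2r//; lra.
  move=> /(ler_wpM2l (ltW m0)); have := ler_wpM2r N0 mK; rewrite -/(fm al be ga).
  by have := mulr_ge0 (ltW k0) N0; lra.
have := fm0 r1 r2 r3; have := fm0 (a ^+ 2 + 1) (2 * a * b) (b ^+ 2).
have := fm0 (c ^+ 2) (2 * c * d) (d ^+ 2 + 1) => f3 f2 f1.
split.
- apply: (bound _ r1 r2 r3); last by rewrite /K; lra.
  by rewrite /q /qform !expr2 !(ReD, ReM, ImM) /= /r1 /r2 /r3; ring.
- rewrite -[cmod y1 ^+ 2]ger0_norm ?sqr_ge0//.
  apply: (bound _ (a ^+ 2 + 1) (2 * a * b) (b ^+ 2)); last by rewrite /K; lra.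
  by rewrite sqr_cmod /=; ring.
- rewrite -[cmod y2 ^+ 2]ger0_norm ?sqr_ge0//.
  apply: (bound _ (c ^+ 2) (2 * c * d) (d ^+ 2 + 1)); last by rewrite /K; lra.
  by rewrite sqr_cmod /=; ring.
Qed.

End QuadraticForms.

(** * Matrices of size two in coordinates *)

Section Coordinates.
Variable R : realType.

Lemma det2 (A : 'M[R]_2) :
  \det A = A ord0 ord0 * A ord_max ord_max - A ord0 ord_max * A ord_max ord0.
Proof.
rewrite (expand_det_row _ ord0) !big_ord_recl big_ord0 /cofactor !det_mx11 !mxE /=.
rewrite expr0 expr1 mul1r mulN1r addr0 mulrN.
by congr (_ * A _ _ - A _ _ * A _ _); exact: val_inj.
Qed.

Lemma mulmx2E (S : pzRingType) (n : nat) (A : 'M[S]_2) (B : 'M[S]_(2, n)) i j :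
  (A *m B) i j = A i ord0 * B ord0 j + A i ord_max * B ord_max j.
Proof.
rewrite mxE !big_ord_recl big_ord0 addr0; congr (_ + A _ _ * B _ _); exact: val_inj.
Qed.

Lemma ord2P (i : 'I_2) : i = ord0 \/ i = ord_max.
Proof. by case: i => [[|[|//]] h]; [left|right]; exact: val_inj. Qed.

Lemma coord_eq (z w : C2 R) : coord1 z = coord1 w -> coord2 z = coord2 w -> z = w.
Proof.
move=> z1 z2; apply/matrixP => i j; rewrite (ord1 j).
by case: (ord2P i) => ->.
Qed.

Lemma AiR2_coord (A : 'M[R]_2) y : AiR2 A y -> exists x1 x2 : R,
  coord1 y = Complex (A ord0 ord0 * x1 + A ord0 ord_max * x2) x1 /\
  coord2 y = Complex (A ord_max ord0 * x1 + A ord_max ord_max * x2) x2.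
Proof.
case=> x ->; exists (x ord0 ord0), (x ord_max ord0).
rewrite /coord1 /coord2 !mulmx2E !mxE /=.
by split; apply/eqP; rewrite eq_complex !(ReD, ImD, ReM, ImM) /=;
  apply/andP; split; apply/eqP; rewrite /=; ring.
Qed.

Lemma R2_coord (y : C2 R) : R2 y <-> Im (coord1 y) = 0 /\ Im (coord2 y) = 0.
Proof.
split=> [[x ->]|[I1 I2]]; first by rewrite /coord1 /coord2 !mxE.
exists (\matrix_(i, j) Re (y i j)); apply: coord_eq; rewrite /coord1 /coord2 !mxE;
  by apply/eqP; rewrite eq_complex /= ?I1 ?I2 !eqxx.
Qed.

End Coordinates.

(* The witness is [J [A, B]], with [J] the rotation by a right angle. *)
Lemma commutator_form (R : realType) (A B : 'M[R]_2) : exists s1 s2 s3 : R,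
  [/\ s1 * s3 - s2 ^+ 2 = \det (comm_mx2 A B),
    s1 * A ord0 ord_max + s2 * A ord_max ord_max = s2 * A ord0 ord0 + s3 * A ord_max ord0
  & s1 * B ord0 ord_max + s2 * B ord_max ord_max = s2 * B ord0 ord0 + s3 * B ord_max ord0].
Proof.
pose C := comm_mx2 A B; exists (C ord_max ord0), (- C ord0 ord0), (- C ord0 ord_max).
have CE i j : C i j = A i ord0 * B ord0 j + A i ord_max * B ord_max j
    - (B i ord0 * A ord0 j + B i ord_max * A ord_max j).
  by rewrite /C /comm_mx2 mxE [in X in _ + X]mxE !mulmx2E.
by rewrite -/C det2 !CE; split; ring.
Qed.

(** * Assembly for the three planes *)

Theorem theorem1p3 (R : realType) (P0 P1 P2 : set (C2 R))
  (g : 'M[R[i]]_2) (A1 A2 : 'M[R]_2) :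
  totally_real_plane P0 -> totally_real_plane P1 -> totally_real_plane P2 ->
  P0 0 -> P1 0 -> P2 0 ->
  P0 `&` P1 = [set 0] -> P0 `&` P2 = [set 0] ->
  g \in unitmx ->
  mx_image g P0 = @R2 R -> mx_image g P1 = AiR2 A1 -> mx_image g P2 = AiR2 A2 ->
  loc_poly_convex (P0 `|` P1) 0 ->
  loc_poly_convex (P0 `|` P2) 0 ->
  loc_poly_convex (P1 `|` P2) 0 ->
  (0 < \det (comm_mx2 A1 A2) /\ 0 < \det A1 /\ 0 < \det A2) \/
  (\det (comm_mx2 A1 A2) < 0 /\ \det A1 < 0 /\ \det A2 < 0) ->
  loc_poly_convex (P0 `|` P1 `|` P2) 0.
Proof.
move=> [rP0 _] [rP1 _] [rP2 _] P00 _ _ _ _ ug gP0 gP1 gP2 pc01 pc02 pc12 sgn.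
have pc1 E : real_cone R E -> loc_poly_convex E 0 -> poly_convex (E `&` cball2 0 1).
  by move=> cE [_ [r [r0]]]; exact: poly_convex_scale.
have [cP0 cP1 cP2] : [/\ real_cone R P0, real_cone R P1 & real_cone R P2].
  by split; exact: real_plane_cone.
have {}pc01 := pc1 _ (real_coneU R _ _ cP0 cP1) pc01.
have {}pc02 := pc1 _ (real_coneU R _ _ cP0 cP2) pc02.
have {pc1}pc12 := pc1 _ (real_coneU R _ _ cP1 cP2) pc12.
have [s1 [s2 [s3 [sD sA1 sA2]]]] := commutator_form R A1 A2.
(* In both cases the commutator and the [Aj] have determinants of the same sign, so the two cases
   merge here. *)
have dA1 : 0 < (s1 * s3 - s2 ^+ 2) * \det A1.
  by rewrite sD; case: sgn => [[? [? ?]]|[? [? ?]]]; [exact: mulr_gt0|rewrite nmulr_rgt0].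
have dA2 : 0 < (s1 * s3 - s2 ^+ 2) * \det A2.
  by rewrite sD; case: sgn => [[? [? ?]]|[? [? ?]]]; [exact: mulr_gt0|rewrite nmulr_rgt0].
rewrite det2 in dA1; rewrite det2 in dA2.
pose Y i : {poly {poly R[i]}} := (g i ord0)%:P%:P * 'X%:P + (g i ord_max)%:P%:P * 'X.
have YE i w : bieval R (Y i) w = (g *m w) i ord0.
  by rewrite mulmx2E bievalD !bievalM !bievalC bieval_coord1 bieval_coord2.
pose Y1 := Y ord0; pose Y2 := Y ord_max.
have Y1E w : bieval R Y1 w = coord1 (g *m w) by exact: YE.
have Y2E w : bieval R Y2 w = coord2 (g *m w) by exact: YE.
pose Q := (Complex s1 0)%:P%:P * Y1 ^+ 2 + (Complex (2 * s2) 0)%:P%:P * (Y1 * Y2)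
  + (Complex s3 0)%:P%:P * Y2 ^+ 2.
have QE w : bieval R Q w = qform R s1 s2 s3 (bieval R Y1 w) (bieval R Y2 w).
  rewrite /Q 2!bievalD (bievalM _ _ (Y1 ^+ 2)) (bievalM _ _ (Y1 * Y2)).
  by rewrite (bievalM _ _ (Y2 ^+ 2)) !bievalX (bievalM _ Y1) !bievalC.
have P0P w : P0 w <-> Im (bieval R Y1 w) = 0 /\ Im (bieval R Y2 w) = 0.
  rewrite Y1E Y2E -R2_coord -gP0; split=> [P0w|[z [P0z /(can_inj (mulKmx ug)) ->]]//].
  by exists w.
have plane A P : mx_image g P = AiR2 A ->
    s1 * A ord0 ord_max + s2 * A ord_max ord_max =
      s2 * A ord0 ord0 + s3 * A ord_max ord0 ->
    0 < (s1 * s3 - s2 ^+ 2) *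
      (A ord0 ord0 * A ord_max ord_max - A ord0 ord_max * A ord_max ord0) ->
    exists e k : R, [/\ e ^+ 2 = 1, 0 < k <= 1 & forall w, P w ->
      [/\ k * `|Re (bieval R Q w)| <= e * Im (bieval R Q w),
        k * cmod (bieval R Y1 w) ^+ 2 <= e * Im (bieval R Q w)
      & k * cmod (bieval R Y2 w) ^+ 2 <= e * Im (bieval R Q w)]].
  move=> gP sA dA; have [e [k [e1 k01 sec]]] := qform_sector R s1 s2 s3 _ _ _ _ sA dA.
  exists e, k; split=> // w Pw; rewrite QE Y1E Y2E.
  have : AiR2 A (g *m w) by rewrite -gP; exists w.
  by case/AiR2_coord=> x1 [x2 [-> ->]]; exact: sec.
have [e1 [k1 [e11 /andP[k10 k11] sec1]]] := plane A1 P1 gP1 sA1 dA1.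
have [e2 [k2 [e21 /andP[k20 k21] sec2]]] := plane A2 P2 gP2 sA2 dA2.
pose k := Num.min k1 k2.
have k01 : 0 < k <= 1 by rewrite lt_min k10 k20 ge_min k11.
have kk1 : k <= k1 by rewrite ge_min lexx.
have kk2 : k <= k2 by rewrite ge_min lexx orbT.
have QR w : P0 w -> Im (bieval R Q w) = 0.
  move=> /P0P[I1 I2]; rewrite QE /qform !expr2 !(ImD, ImM, ReM) /= I1 I2; ring.
have leQ (e : R) w : e ^+ 2 = 1 -> e * Im (bieval R Q w) <= cmod (bieval R Q w).
  move=> ee; apply: le_trans (normr_Im_le _ _); apply: le_trans (ler_norm _) _.
  rewrite normrM (_ : `|e| = 1) ?mul1r//.
  by apply/eqP; rewrite -(@eqrXn2 _ 2)// real_normK ?num_real// ee expr1n.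
have sub3 w : (P1 `|` P2) w ->
    k * cmod (bieval R Y1 w) ^+ 2 <= cmod (bieval R Q w) /\
    k * cmod (bieval R Y2 w) ^+ 2 <= cmod (bieval R Q w).
  have y1 := sqr_ge0 (cmod (bieval R Y1 w)); have y2 := sqr_ge0 (cmod (bieval R Y2 w)).
  case=> [/sec1[_ h1 h2]|/sec2[_ h1 h2]].
    by have := leQ _ w e11 => le1; split; apply: le_trans le1; nra.
  by have := leQ _ w e21 => le1; split; apply: le_trans le1; nra.
have g0 : bieval R Y1 0 = 0 /\ bieval R Y2 0 = 0.
  by rewrite Y1E Y2E mulmx0 /coord1 /coord2 !mxE.
case: g0 => Y10 Y20.
split; first by left; left.
exists 1; split=> //.
pose B : set (C2 R) := cball2 0 1.
(* This is how the pairwise unions enter: the hull of a part stays in a convex pair containing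
   it. *)
have subE (E F : set (C2 R)) : E `<=` F -> poly_convex (F `&` B) ->
    poly_hull (E `&` B) `<=` F `&` B.
  move=> EF pcF z Ez; apply: pcF; apply: poly_hullS Ez => w [/EF Fw Bw]; by split.
have common (e : R) Xa Xb : e ^+ 2 = 1 ->
    (P0 `|` P1 `|` P2) `&` B = Xa `|` Xb ->
    (forall w, Xa w -> e * Im (bieval R Q w) <= 0) ->
    (forall w, Xb w -> k * `|Re (bieval R Q w)| <= e * Im (bieval R Q w)) ->
    poly_hull Xa `<=` (P0 `|` P1 `|` P2) `&` B ->
    poly_hull Xb `<=` (P0 `|` P1 `|` P2) `&` B ->
    poly_convex ((P0 `|` P1 `|` P2) `&` B).
  move=> ee XE ha hb hXa hXb.
  apply: (poly_convex_union R 1 e k P0 _ Xa Xb Q Y1 Y2 ltr01 ee k01 P0P P00 Y10 Y20 XE _ _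
    ha hb _ hXa hXb).
  - by move=> w [_ Bw].
  - by move=> w [P0w Bw]; split=> //; left; left.
  - by move=> w [[[P0w|P1w]|P2w] _]; [left|right; apply: sub3; left|right; apply: sub3; right].
have [e12|e12] := eqVneq e1 e2.
  (* Equal signs: [P0] lies on the boundary of the half-plane, [P1] and [P2] share the sector. *)
  apply: (common e1 (P0 `&` B) ((P1 `|` P2) `&` B)) => //.
  - by rewrite -setUA setIUl.
  - by move=> w [/QR -> _]; rewrite mulr0.
  - rewrite e12 in sec1 *; move=> w [[/sec1[h _ _]|/sec2[h _ _]] _];
      by apply: le_trans h; rewrite ler_wpM2r.
  - apply: subset_trans (subE P0 (P0 `|` P1) _ pc01) _; first by move=> w; left.
    by move=> w [Ew Bw]; split=> //; left.
  - apply: subset_trans (subE (P1 `|` P2) _ _ pc12) _; first by [].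
    by move=> w [[Ew|Ew] Bw]; split=> //; [left; right|right].
have {e12} e12 : e1 = - e2.
  apply/eqP; move/eqP: e11; rewrite -e21 eqf_sqr => /orP[/eqP E|//].
  by rewrite E eqxx in e12.
(* Opposite signs: seen with [e2], [P1] falls into the half-plane together with [P0]. *)
apply: (common e2 ((P0 `|` P1) `&` B) (P2 `&` B)) => //.
- by rewrite setIUl.
- move=> w [[/QR ->|/sec1[h _ _]] _]; first by rewrite mulr0.
  have : 0 <= e1 * Im (bieval R Q w) by apply: le_trans h; rewrite mulr_ge0 ?(ltW k10).
  by rewrite e12; lra.
- by move=> w [/sec2[h _ _] _]; apply: le_trans h; rewrite ler_wpM2r.
- apply: subset_trans (subE (P0 `|` P1) _ _ pc01) _; first by [].
  by move=> w [Ew Bw]; split=> //; left.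
- apply: subset_trans (subE P2 (P0 `|` P2) _ pc02) _; first by move=> w; right.
  by move=> w [[Ew|Ew] Bw]; split=> //; [left; left|right].
Qed.
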